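(* Let $\hat\Theta=\Theta\wedge\epsilon\in\Lambda^6\mathbb{R}^{10}$ be the lift to ten dimensions of the $\mathfrak{spin}(7)$-invariant four-form $\Theta$ on $\mathbb{R}^8$, where $\epsilon$ is the volume form of $\mathbb{R}^2\subset\mathbb{R}^{10}=\mathbb{R}^8\oplus\mathbb{R}^2$. With respect to the decomposition $$\Lambda^4\mathbb{R}^{10}=\Lambda^4\mathbb{R}^8\ \oplus\ \Lambda^3\mathbb{R}^8\otimes\mathbb{R}^2\ \oplus\ \Lambda^2\mathbb{R}^8\otimes\Lambda^2\mathbb{R}^2$$ the operator $b_{\hat\Theta}:\Lambda^4\mathbb{R}^{10}\to\Lambda^4\mathbb{R}^{10}$ is given by $$b_{\hat\Theta}=\begin{pmatrix}0&0&6\,\tilde c_\Theta\otimes *\\ 0&\frac94\,b_\Theta\otimes *&0\\ \frac12\,c_\Theta\otimes *&0&0\end{pmatrix}.$$ The eigenvalues of $b_{\hat\Theta}$ (on the complexification), its eigenspaces and their dimensions are as follows, where upper and lower signs correspond: - $0$: $\ \Lambda^4_{(0)}\mathbb{R}^8\oplus\Lambda^4_{(-4)}\mathbb{R}^8\oplus\Lambda^4_{(\frac23)}\mathbb{R}^8\oplus\Lambda^2_{(2)}\mathbb{R}^8\otimes\epsilon$, of dimension $35+1+27+21=84$; - $\pm9i$: $\ \Lambda^3_{(-4)}\mathbb{R}^8\otimes\mathbb{R}_\mp$, of dimension $8$ each; - $\pm\frac32 i$: $\ \Lambda^3_{(\frac23)}\mathbb{R}^8\otimes\mathbb{R}_\pm$,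 of dimension $48$ each; - $\pm6\sqrt2\,i$: $\ \big\{\big(\mp\frac{i}{\sqrt2}\,\tilde c_\Theta(F),\,F\wedge\epsilon\big)\,:\,F\in\Lambda^2_{(-6)}\mathbb{R}^8\big\}$, of dimension $7$ each. Here a pair $(x,F\wedge\epsilon)$ lies in $\Lambda^4\mathbb{R}^8\oplus\Lambda^2\mathbb{R}^8\otimes\Lambda^2\mathbb{R}^2$.
   Context: Euclidean $\mathbb{R}^{10}=\mathbb{R}^8\oplus\mathbb{R}^2$ has orthonormal basis $e_1,\ldots,e_{10}$, with $\mathbb{R}^8=\mathrm{span}\{e_1,\ldots,e_8\}$, $\mathbb{R}^2=\mathrm{span}\{e_9,e_{10}\}$, $\epsilon=e_9\wedge e_{10}$. Indices are raised with the metric, repeated indices are summed, square brackets denote weight-one antisymmetrization, and wedge products use the convention $(\alpha\wedge\beta)_{a_1\ldots a_{p+q}}=\binom{p+q}{p}\alpha_{[a_1\ldots a_p}\beta_{a_{p+1}\ldots a_{p+q}]}$. $\Theta\in\Lambda^4\mathbb{R}^8$ has totally antisymmetric components determined by $\Theta_{ijkl}=1$ for $(ijkl)=(1245),(1276),(1346),(1357),(2356),(2437),(4567),(1238),(4358),(4718),(5168),(5728),(6248),(6738)$, all components with index sets not listed being zero; $\mathfrak{spin}(7)\subset\mathfrak{so}(8)$ is its stabilizer. The operator on ten-dimensional four-forms is $b_{\hat\Theta}(F)_{lmno}=\hat\Theta_{ijk[lmn}F^{ijk}{}_{o]}$. On $\mathbb{R}^8$: $b_\Theta(F)_{ij}=\Theta_{ijkl}F^{kl}$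 on $\Lambda^2$, $b_\Theta(F)_{lmn}=\Theta_{ij[lm}F^{ij}{}_{n]}$ on $\Lambda^3$, $b_\Theta(F)_{ijkl}=\Theta^{mn}{}_{[ij}F_{kl]mn}$ on $\Lambda^4$; $\Lambda^k_{(\beta)}\mathbb{R}^8$ is the $\beta$-eigenspace of $b_\Theta$ on $\Lambda^k\mathbb{R}^8$ (complexified where needed). Further, $c_\Theta:\Lambda^4\mathbb{R}^8\to\Lambda^2\mathbb{R}^8$, $c_\Theta(F)_{ij}=\Theta_{klm[i}F^{klm}{}_{j]}$, and $\tilde c_\Theta:\Lambda^2\mathbb{R}^8\to\Lambda^4\mathbb{R}^8$, $\tilde c_\Theta(F)_{ijkl}=\Theta_{m[ijk}F^m{}_{l]}$. The second tensor factor $*$ is the Hodge operator of $\mathbb{R}^2$: $*1=\epsilon$, $*\epsilon=1$, $*e_9=e_{10}$, $*e_{10}=-e_9$. Elements $F\otimes V$ with $F\in\Lambda^{p}\mathbb{R}^8$, $V\in\Lambda^q\mathbb{R}^2$ are identified with $F\wedge V$; the matrix acts on column vectors of the three summands in the order written. $\mathbb{R}_\pm\subset\mathbb{R}^2\otimes\mathbb{C}$ is the $\pm i$-eigenspace of $*$ on $\mathbb{R}^2$. *)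

(* Defs.v *)
From HB Require Import structures.
From mathcomp Require Import all_boot all_order all_algebra all_fingroup.
From mathcomp Require Import reals complex.

Set Implicit Arguments.
Unset Strict Implicit.
Unset Printing Implicit Defensive.

Import Order.TTheory GRing.Theory Num.Theory.
Local Open Scope ring_scope.

(* Covariant k-tensors on K^10, given by their components.  The basis is
   orthonormal, so raising an index does not change components.  Every operator
   below has rational coefficients, so for K = R[i] it is the complexification
   of the operator for K = R. *)
Notation tensor K k := {ffun k.-tuple 'I_10 -> K^o}.

Definition permt (k : nat) (t : k.-tuple 'I_10) (s : 'S_k) : k.-tuple 'I_10 :=
  [tuple tnth t (s i) | i < k].

(* T_[a_1 ... a_k], with weight one *)
Definition alt (K : numFieldType) (k : nat) (T : tensor K k) : tensor K k :=
  [ffun t => (k`!%:R)^-1 * \sum_(s : 'S_k) (-1) ^+ s * T (permt t s)].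

Definition off_supp (K : numFieldType) (k : nat) (S : {set 'I_10})
    (T : tensor K k) : tensor K k :=
  [ffun t : k.-tuple 'I_10 => if all (fun i => i \in S) t then 0 else T t].

Definition wedge (K : numFieldType) (p q : nat)
    (A : tensor K p) (B : tensor K q) : tensor K (p + q) :=
  'C(p + q, p)%:R *:
    alt [ffun t => A [tuple tnth t (lshift q i) | i < p]
                 * B [tuple tnth t (rshift p j) | j < q]].

(* Basis labels run over 1, ..., 10, whereas 'I_10 starts at 0. *)
Definition idx (i : nat) : 'I_10 := inord i.-1.

Definition evec (K : numFieldType) (i : nat) : tensor K 1 :=
  [ffun t => (t == [tuple idx i])%:R].

Definition one0 (K : numFieldType) : tensor K 0 := [ffun=> 1].

Definition eps (K : numFieldType) : tensor K 2 := wedge (evec K 9) (evec K 10).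

Definition Theta_indices : seq (4.-tuple nat) :=
  [:: [tuple 1; 2; 4; 5]; [tuple 1; 2; 7; 6]; [tuple 1; 3; 4; 6];
      [tuple 1; 3; 5; 7]; [tuple 2; 3; 5; 6]; [tuple 2; 4; 3; 7];
      [tuple 4; 5; 6; 7]; [tuple 1; 2; 3; 8]; [tuple 4; 3; 5; 8];
      [tuple 4; 7; 1; 8]; [tuple 5; 1; 6; 8]; [tuple 5; 7; 2; 8];
      [tuple 6; 2; 4; 8]; [tuple 6; 7; 3; 8]]%N.

(* The listed index sets are pairwise distinct, so at most one term of the
   double sum is nonzero. *)
Definition Theta (K : numFieldType) : tensor K 4 :=
  [ffun t => \sum_(q <- Theta_indices) \sum_(s : 'S_4)
     (-1) ^+ s * (t == permt (map_tuple idx q) s)%:R].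

Definition ThetaHat (K : numFieldType) : tensor K 6 := wedge (Theta K) (eps K).

Definition bhat (K : numFieldType) (Th : tensor K 6) (F : tensor K 4) :
    tensor K 4 :=
  alt [ffun t : 4.-tuple 'I_10 => \sum_i \sum_j \sum_k
         Th [tuple i; j; k; t`_0; t`_1; t`_2] * F [tuple i; j; k; t`_3]].

Definition b2 (K : numFieldType) (Th : tensor K 4) (F : tensor K 2) :
    tensor K 2 :=
  [ffun t : 2.-tuple 'I_10 => \sum_k \sum_l
     Th [tuple t`_0; t`_1; k; l] * F [tuple k; l]].

Definition b3 (K : numFieldType) (Th : tensor K 4) (F : tensor K 3) :
    tensor K 3 :=
  alt [ffun t : 3.-tuple 'I_10 => \sum_i \sum_j
         Th [tuple i; j; t`_0; t`_1] * F [tuple i; j; t`_2]].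

Definition b4 (K : numFieldType) (Th : tensor K 4) (F : tensor K 4) :
    tensor K 4 :=
  alt [ffun t : 4.-tuple 'I_10 => \sum_m \sum_n
         Th [tuple m; n; t`_0; t`_1] * F [tuple t`_2; t`_3; m; n]].

Definition c4 (K : numFieldType) (Th : tensor K 4) (F : tensor K 4) :
    tensor K 2 :=
  alt [ffun t : 2.-tuple 'I_10 => \sum_k \sum_l \sum_m
         Th [tuple k; l; m; t`_0] * F [tuple k; l; m; t`_1]].

Definition ctilde (K : numFieldType) (Th : tensor K 4) (F : tensor K 2) :
    tensor K 4 :=
  alt [ffun t : 4.-tuple 'I_10 => \sum_m
         Th [tuple m; t`_0; t`_1; t`_2] * F [tuple m; t`_3]].

(* The Hodge operator of R^2 in degrees 0, 1 and 2: 1 -> eps, e_9 -> e_10,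
   e_10 -> - e_9, eps -> 1 *)
Definition star0 (K : numFieldType) (f : tensor K 0) : tensor K 2 :=
  f [tuple] *: eps K.

Definition star1 (K : numFieldType) (V : tensor K 1) : tensor K 1 :=
  V [tuple idx 9] *: evec K 10 - V [tuple idx 10] *: evec K 9.

Definition star2 (K : numFieldType) (W : tensor K 2) : tensor K 0 :=
  W [tuple idx 9; idx 10] *: one0 K.

Lemma scale_regE (K : numFieldType) (a x : K) : a *: (x : K^o) = a * x.
Proof. by []. Qed.

Lemma alt_is_linear (K : numFieldType) (k : nat) :
  linear (@alt K k : tensor K k -> tensor K k).
Proof.
move=> a u v; apply/ffunP => t; rewrite !ffunE ?scale_regE.
rewrite mulrCA -mulrDr; congr (_ * _).
rewrite mulr_sumr -big_split; apply: eq_bigr => s _ /=.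
by rewrite !ffunE ?scale_regE mulrDr mulrCA.
Qed.
HB.instance Definition _ (K : numFieldType) (k : nat) :=
  GRing.isLinear.Build K (tensor K k) (tensor K k) *:%R (@alt K k)
    (@alt_is_linear K k).

Lemma off_supp_is_linear (K : numFieldType) (k : nat) (S : {set 'I_10}) :
  linear (@off_supp K k S).
Proof.
move=> a u v; apply/ffunP => t; rewrite !ffunE.
by case: ifP => _; rewrite ?scaler0 ?addr0.
Qed.
HB.instance Definition _ (K : numFieldType) (k : nat) (S : {set 'I_10}) :=
  GRing.isLinear.Build K (tensor K k) (tensor K k) *:%R (@off_supp K k S)
    (@off_supp_is_linear K k S).

Local Ltac contraction_linear :=
  let a := fresh "a" in let u := fresh "u" in let v := fresh "v" in
  move=> a u v; rewrite -?[in RHS]linearP; try congr (alt _);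
  apply/ffunP => t; rewrite !ffunE ?scale_regE;
  do ? (rewrite mulr_sumr -big_split; apply: eq_bigr => ? _ /=);
  by rewrite !ffunE ?scale_regE mulrDr mulrCA.

Lemma bhat_is_linear (K : numFieldType) (Th : tensor K 6) : linear (bhat Th).
Proof. contraction_linear. Qed.
HB.instance Definition _ (K : numFieldType) (Th : tensor K 6) :=
  GRing.isLinear.Build K (tensor K 4) (tensor K 4) *:%R (bhat Th)
    (bhat_is_linear Th).

Lemma b2_is_linear (K : numFieldType) (Th : tensor K 4) : linear (b2 Th).
Proof. contraction_linear. Qed.
HB.instance Definition _ (K : numFieldType) (Th : tensor K 4) :=
  GRing.isLinear.Build K (tensor K 2) (tensor K 2) *:%R (b2 Th)
    (b2_is_linear Th).

Lemma b3_is_linear (K : numFieldType) (Th : tensor K 4) : linear (b3 Th).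
Proof. contraction_linear. Qed.
HB.instance Definition _ (K : numFieldType) (Th : tensor K 4) :=
  GRing.isLinear.Build K (tensor K 3) (tensor K 3) *:%R (b3 Th)
    (b3_is_linear Th).

Lemma b4_is_linear (K : numFieldType) (Th : tensor K 4) : linear (b4 Th).
Proof. contraction_linear. Qed.
HB.instance Definition _ (K : numFieldType) (Th : tensor K 4) :=
  GRing.isLinear.Build K (tensor K 4) (tensor K 4) *:%R (b4 Th)
    (b4_is_linear Th).

Lemma star1_is_linear (K : numFieldType) : linear (@star1 K).
Proof.
move=> a u v; rewrite /star1 !ffunE !scalerDl -!scalerA scalerBr opprD.
by rewrite addrACA.
Qed.
HB.instance Definition _ (K : numFieldType) :=
  GRing.isLinear.Build K (tensor K 1) (tensor K 1) *:%R (@star1 K)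
    (@star1_is_linear K).

(* The operators b2, b3, b4, c4 and ctilde of R^8 are applied to Lam K k R8
   with Th = Theta, whose components vanish outside R^8; the contractions over
   'I_10 then reduce to contractions over R^8. *)

(* Lam K k S is the exterior power Λ^k (span {e_i : i in S}) inside Λ^k K^10:
   the totally antisymmetric tensors all of whose nonzero components have
   their indices in S. *)
Definition Lam (K : numFieldType) (k : nat) (S : {set 'I_10}) :
    {vspace tensor K k} :=
  (fixedSpace (linfun (@alt K k)) :&: lker (linfun (@off_supp K k S)))%VS.

Definition R10 : {set 'I_10} := [set: 'I_10].
Definition R8 : {set 'I_10} := [set i : 'I_10 | (i < 8)%N].
Definition R2 : {set 'I_10} := [set i : 'I_10 | (8 <= i)%N].

Lemma memLam (K : numFieldType) (k : nat) (S : {set 'I_10}) (F : tensor K k) :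
  F \in Lam K k S <->
  (forall t s, F (permt t s) = (-1) ^+ s * F t) /\
  (forall t : k.-tuple 'I_10, ~~ all (fun i => i \in S) t -> F t = 0).
Proof.
rewrite memv_cap memv_ker lfunE /=.
have permtM t (s1 s2 : 'S_k) : permt (permt t s1) s2 = permt t (s2 * s1)%g.
  by apply: eq_from_tnth => i; rewrite !tnth_mktuple permM.
split=> [/andP[/fixedSpaceP altF /eqP offF]|[asymF offF]].
  split=> [t s|t St]; last by have /ffunP/(_ t) := offF; rewrite !ffunE (negPf St).
  rewrite lfunE /= in altF.
  rewrite -altF !ffunE mulrCA; congr (_ * _); rewrite mulr_sumr.
  rewrite (reindex_inj (mulIg s^-1%g)) /=; apply: eq_bigr => r _.
  rewrite permtM mulgKV odd_permM odd_permV signr_addb.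
  by rewrite [RHS]mulrA [(-1) ^+ r * _]mulrC.
apply/andP; split.
  apply/fixedSpaceP; rewrite lfunE /=; apply/ffunP => t; rewrite !ffunE.
  under eq_bigr => s _ do rewrite asymF mulrA -signr_addb addbb mul1r.
  have k0 : k`!%:R != 0 :> K by rewrite pnatr_eq0 -lt0n fact_gt0.
  rewrite sumr_const -[#|_|]/#|{: 'S_k}| card_Sn -[F t *+ _]mulr_natl.
  exact: (mulKf k0 (F t : K)).
apply/eqP/ffunP => t; rewrite !ffunE; by case: ifPn => // /offF.
Qed.

(* U ⊗ V, with F ⊗ W identified with F ∧ W *)
Definition tensv (K : numFieldType) (p q : nat)
    (U : {vspace tensor K p}) (V : {vspace tensor K q}) :
    {vspace tensor K (p + q)} :=
  <<[seq wedge u v | u <- vbasis U, v <- vbasis V]>>%VS.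

(* The a-eigenspace of f on U, a subspace that f maps to itself *)
Definition eig (K : numFieldType) (k : nat) (U : {vspace tensor K k})
    (f : {linear tensor K k -> tensor K k}) (a : K) : {vspace tensor K k} :=
  (U :&: passmx.leigenspace (linfun f) a)%VS.

Definition Lam2_ (K : numFieldType) (beta : K) : {vspace tensor K 2} :=
  eig (Lam K 2 R8) (b2 (Theta K)) beta.
Definition Lam3_ (K : numFieldType) (beta : K) : {vspace tensor K 3} :=
  eig (Lam K 3 R8) (b3 (Theta K)) beta.
Definition Lam4_ (K : numFieldType) (beta : K) : {vspace tensor K 4} :=
  eig (Lam K 4 R8) (b4 (Theta K)) beta.

(* For mu = 'i and mu = - 'i these are the lines R_+ and R_- *)
Definition Rline (K : numFieldType) (mu : K) : {vspace tensor K 1} :=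
  eig (Lam K 1 R2) (@star1 K) mu.

(* Main.v *)
(* The monomials e_l form bases of the exterior powers, and contraction with
   Theta acts on them by Laplace expansion with rational coefficients, so a
   linear identity between the operators need only be evaluated on finitely many
   monomials.  This gives the three blocks of b_hat and the relations
     c ctilde = 3 b2 - 6,   c b4 = - 2 c,   ctilde b2 = - 6 ctilde,
   as well as annihilating polynomials with simple roots of b2, 3 b3 and 6 b4.
   The dimension of an eigenspace of b2, b3 or b4 is then read off a trace: the
   product of the factors b - r over the other roots r is a multiple of the
   projection onto it.  The relations place the listed spaces inside the
   eigenspaces of b_hat.  Their dimensions 84 + 2 (8 + 48 + 7) = 210 exhaust
   Lambda^4 R^10, and eigenspaces are independent, so these are the whole
   eigenspaces and there are no other eigenvalues. *)

From HB Require Import structures.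
Require Import Defs.
From mathcomp Require Import all_boot all_order all_algebra all_fingroup.
From mathcomp Require Import reals complex.
From Corelib Require BinNums.
From mathcomp Require Import ssrZ ring zify.

Set Implicit Arguments.
Unset Strict Implicit.
Unset Printing Implicit Defensive.

Import Order.TTheory GRing.Theory Num.Theory.
Local Open Scope ring_scope.

(** Neither the tensors, which are functions on tuples of indices with values in an abstract field,
    nor the determinants behind [mono] can be evaluated. Each operator is therefore paired with a
    function on lists of binary integers and labels, which the kernel can run. Integrality dictates
    the constants: antisymmetrizing a product of two monomials costs a binomial coefficient, so what
    is computed is b2, 3 b3, 6 b4, 2 c, 4 ctilde and 4 b_hat. The annihilating polynomial of b4 has
    a fourth root -2, absent from the listed eigenspaces: it is the one root at which c b4 = - 2 c
    leaves room for a nonzero c. The value 6 sqrt 2 comes from the off-diagonal blocks: on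
    Lambda^2_(-6) one has c ctilde = 3 (-6) - 6 = -24, so the square of b_hat is 6 (1/2) (-24) = -72
    there. The spectrum is found over any numeric field with elements I and r > 0 such that I^2 = -1
    and r^2 = 2; the field R[i] enters only in the final theorem. *)

(** * Monomials and the exterior powers *)

(* The monomial e_{l_1} /\ ... /\ e_{l_k}, with labels starting at 0: its
   component at t is the determinant of the Kronecker symbols of l_i and t_j. *)
Definition mono (K : numFieldType) (k : nat) (l : seq nat) : tensor K k :=
  [ffun t : k.-tuple 'I_10 =>
     \det (\matrix_(i < k, j < k) (nth 0%N l i == tnth t j :> nat)%:R)].

Definition inset (s : seq nat) : {set 'I_10} := [set i : 'I_10 | val i \in s].

Lemma mono_antisym (K : numFieldType) k l (t : k.-tuple 'I_10) (s : 'S_k) :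
  mono K k l (permt t s) = (-1) ^+ s * mono K k l t.
Proof.
rewrite !ffunE; set M := (X in _ = _ * \det X).
have -> : (\matrix_(i, j) (nth 0%N l i == tnth (permt t s) j :> nat)%:R : 'M[K]_k) = col_perm s M.
  by apply/matrixP => i j; rewrite !mxE tnth_mktuple.
by rewrite col_permE det_mulmx det_perm odd_permV mulrC.
Qed.

Lemma mono_Lam (K : numFieldType) k l s :
  size l = k -> {subset l <= s} -> mono K k l \in Lam K k (inset s).
Proof.
move=> sz_l sub_l; apply/memLam; split=> [t p|t]; first exact: mono_antisym.
case/allPn=> x /tnthP[j ->]; rewrite inE => tj_s; rewrite ffunE (expand_det_col _ j).
rewrite big1 // => i _; rewrite mxE; case: eqP => [e|]; last by rewrite mul0r.
by case/negP: tj_s; rewrite /= -e sub_l // mem_nth // sz_l.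
Qed.

Lemma alt_antisym (K : numFieldType) k (T : tensor K k) t (s : 'S_k) :
  alt T (permt t s) = (-1) ^+ s * alt T t.
Proof.
rewrite !ffunE mulrCA; congr (_ * _); rewrite mulr_sumr.
rewrite (reindex_inj (mulIg s^-1%g)) /=; apply: eq_bigr => r _.
have -> : permt (permt t s) (r * s^-1)%g = permt t r.
  by apply: eq_from_tnth => i; rewrite !tnth_mktuple permM permKV.
by rewrite odd_permM odd_permV signr_addb mulrA [(-1) ^+ r * _]mulrC.
Qed.

Lemma alt_Lam (K : numFieldType) k (T : tensor K k) : alt T \in Lam K k R10.
Proof.
apply/memLam; split=> [t s|t /allPn[x]]; last by rewrite inE.
exact: alt_antisym.
Qed.

Lemma alt_id (K : numFieldType) k (T : tensor K k) :
  (forall t s, T (permt t s) = (-1) ^+ s * T t) -> alt T = T.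
Proof.
move=> asymT; have: T \in Lam K k R10.
  by apply/memLam; split=> // t /allPn[x]; rewrite inE.
by rewrite memv_cap => /andP[/fixedSpaceP]; rewrite lfunE.
Qed.

(** Transposing two equal entries fixes t but changes the sign of the component, and 2 is invertible
    in K. *)
Lemma antisym_dup (K : numFieldType) k (T : tensor K k) (t : k.-tuple 'I_10) :
  (forall t s, T (permt t s) = (-1) ^+ s * T t) -> ~~ uniq t -> T t = 0.
Proof.
move=> asymT /tuple_uniqP t_dup.
have [i [j [neq_ij eq_t]]] : exists i j, i != j /\ tnth t i = tnth t j.
  case: (pickP (fun p : 'I_k * 'I_k => (p.1 != p.2) && (tnth t p.1 == tnth t p.2))).
    by move=> [i j] /= /andP[? /eqP]; exists i, j.
  move=> none; case: t_dup => i j e; apply/eqP; move/negbT: (none (i, j)).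
  by rewrite /= negb_and negbK e eqxx orbF.
have := asymT t (tperm i j); rewrite odd_tperm neq_ij mulN1r.
have -> : permt t (tperm i j) = t.
  apply: eq_from_tnth => x; rewrite tnth_mktuple.
  by case: tpermP => [->|->|].
by move/eqP; rewrite -addr_eq0 -mulr2n mulrn_eq0 /= => /eqP.
Qed.

(** For increasing s this enumerates the k-subsets of s as increasing lists, so that the index set
    of a basis is a concrete list which the kernel can run through. *)
Fixpoint subs (k : nat) (s : seq nat) : seq (seq nat) :=
  match k, s with
  | 0, _ => [:: [::]]
  | _.+1, [::] => [::]
  | k'.+1, x :: s' => [seq x :: l | l <- subs k' s'] ++ subs k s'
  end.

Lemma mem_subs k s l : uniq s -> (l \in subs k s) = subseq l s && (size l == k).
Proof.
elim: s k l => [|x s IHs] [|k] l //=.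
- by rewrite inE; case: l.
- by rewrite in_nil; case: l.
- by move=> _; rewrite inE; case: l => [|y l]; rewrite ?sub0seq //= andbF.
case/andP=> x_s uniq_s; rewrite mem_cat IHs //.
case: l => [|y l] /=.
  by rewrite andbF orbF; apply/mapP => -[].
case: (eqVneq y x) => [->|neq_yx].
  rewrite (mem_map (f := cons x)) ?IHs // ?eqSS; last by move=> ? ? [].
  case: (boolP (subseq (x :: l) s)) => [|_]; rewrite ?orbF // => /mem_subseq/(_ x).
  by rewrite mem_head (negPf x_s) => /(_ isT).
rewrite [X in X || _](_ : _ = false) //; apply/mapP => -[? _ [e _]].
by rewrite e eqxx in neq_yx.
Qed.

Lemma subs_uniq k s : uniq s -> uniq (subs k s).
Proof.
elim: s k => [|x s IHs] [|k] //= /andP[x_s uniq_s].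
rewrite cat_uniq map_inj_uniq ?IHs //; last by move=> ? ? [].
rewrite andbT /=; apply/hasPn => l; rewrite mem_subs // => /andP[sub_l _].
apply/mapP => -[m _ e]; case/negP: x_s; apply: (mem_subseq sub_l).
by rewrite e mem_head.
Qed.

Arguments subs : simpl never.

(* inord sends labels that are at least 10 to 0. *)
Definition tup (k : nat) (l : seq nat) : k.-tuple 'I_10 :=
  [tuple inord (nth 0%N l i) | i < k].

Definition ordered (s : seq nat) := sorted ltn s && all (fun i => i < 10)%N s.

Lemma ordered_uniq s : ordered s -> uniq s.
Proof. by case/andP=> /(sorted_uniq ltn_trans ltnn). Qed.

Lemma val_tup k l : size l = k -> all (fun i => i < 10)%N l -> map val (tup k l) = l.
Proof.
move=> <- /all_nthP l10; apply: (@eq_from_nth _ 0%N) => [|i].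
  by rewrite size_map size_tuple.
rewrite size_map size_tuple => lti.
rewrite (nth_map (inord 0)) ?size_tuple //.
rewrite -(tnth_nth _ _ (Ordinal lti)) tnth_mktuple /= inordK // l10 //.
Qed.

Lemma nth_valt k (t : k.-tuple 'I_10) (i : 'I_k) : tnth t i = nth 0%N (map val t) i :> nat.
Proof.
by rewrite (nth_map (tnth t i)) ?size_tuple // -tnth_nth.
Qed.

(** For equal label lists the Kronecker matrix is the identity; otherwise some label of l is missing
    from t and its row vanishes. *)
Lemma mono_sortedE (K : numFieldType) k (l : seq nat) (t : k.-tuple 'I_10) :
  sorted ltn l -> size l = k -> sorted ltn (map val t) ->
  mono K k l t = (l == map val t)%:R.
Proof.
move=> l_s sz_l t_s; rewrite ffunE; case: eqVneq => [->|neq_lt].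
  rewrite -[RHS](det1 K k); congr (\det _); apply/matrixP => i j; rewrite !mxE.
  rewrite nth_valt nth_uniq ?size_map ?size_tuple //.
  exact: (sorted_uniq ltn_trans ltnn t_s).
have [i l_t]: exists i : 'I_k, nth 0%N l i \notin map val t.
  case: (pickP (fun i : 'I_k => nth 0%N l i \notin map val t)) => [i|none]; first by exists i.
  have ul: uniq l by apply: (sorted_uniq ltn_trans ltnn l_s).
  have sub_lt: {subset l <= map val t}.
    move=> x /(nthP 0%N)[i lti <-]; rewrite sz_l in lti.
    by have /negbT := none (Ordinal lti); rewrite negbK.
  case/eqP: neq_lt; apply: (irr_sorted_eq ltn_trans ltnn l_s t_s).
  have ut: uniq (map val t) by apply: (sorted_uniq ltn_trans ltnn t_s).
  have [] := uniq_min_size ul sub_lt; last by [].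
  by rewrite size_map size_tuple sz_l.
rewrite (expand_det_row _ i) big1 // => j _; rewrite mxE nth_valt.
case: eqP => [e|]; last by rewrite mul0r.
by case/negP: l_t; rewrite e mem_nth // size_map size_tuple.
Qed.

Lemma subs_sorted k s l : ordered s -> l \in subs k s ->
  [/\ sorted ltn l, size l = k, {subset l <= s} & all (fun i => i < 10)%N l].
Proof.
move=> s_ord; have us := ordered_uniq s_ord; case/andP: s_ord => s_s s10.
rewrite mem_subs // => /andP[sub_l /eqP sz_l]; split=> //.
- by apply: subseq_sorted sub_l s_s; apply: ltn_trans.
- exact: mem_subseq.
by apply/allP => x /(mem_subseq sub_l); apply: (allP s10).
Qed.

(** Both sides are antisymmetric and supported on s, so they need only agree at increasing
    tuples. *)
Lemma Lam_expand (K : numFieldType) k s (F : tensor K k) :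
  ordered s -> F \in Lam K k (inset s) ->
  F = \sum_(l <- subs k s) F (tup k l) *: mono K k l.
Proof.
move=> s_ord F_s; have [asymF suppF] := (memLam _ _).1 F_s.
set G := (X in _ = X).
have G_s : G \in Lam K k (inset s).
  rewrite /G big_seq; apply: memv_suml => l l_s; apply: memvZ.
  by have [_ sz_l sub_l _] := subs_sorted s_ord l_s; apply: mono_Lam.
have [asymG suppG] := (memLam _ _).1 G_s.
have us := ordered_uniq s_ord.
apply/ffunP => t; case: (boolP (all (fun i => i \in inset s) t)) => [t_s|t_s]; last first.
  by rewrite suppF ?suppG.
case: (boolP (uniq t)) => [ut|dup]; last by rewrite !antisym_dup.
(* The increasing rearrangement of t, at which only the monomial of [u] survives in the sum. *)
pose u := sort leq (map val t).
have sz_u : size u == k by rewrite size_sort size_map size_tuple.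
pose t' : k.-tuple 'I_10 := tup k u.
have valt' : map val t' = u.
  apply: val_tup; first exact/eqP.
  by apply/allP => x; rewrite mem_sort => /mapP[i _ ->]; apply: ltn_ord.
have /tuple_permP[p /val_inj ep] : perm_eq t' t.
  by apply: (perm_map_inj val_inj); rewrite valt' perm_sort.
have u_sorted : sorted ltn u.
  by rewrite ltn_sorted_uniq_leq sort_sorted ?sort_uniq ?(map_inj_uniq val_inj) ?ut //; apply: leq_total.
have {}asym T : (forall t s, T (permt t s) = (-1) ^+ s * T t) -> T t = (-1) ^+ p * T t' :> K.
  by move=> asymT; rewrite ep asymT mulrA -signr_addb addbb mul1r.
rewrite !asym //; congr (_ * _).
have u_subs : u \in subs k s.
  case/andP: s_ord => s_s _; rewrite mem_subs // sz_u andbT.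
  have -> : u = [seq x <- s | x \in u]; last exact: filter_subseq.
  apply: (irr_sorted_eq ltn_trans ltnn) => // [|x].
    by apply: sorted_filter => //; apply: ltn_trans.
  rewrite mem_filter; case: (boolP (x \in u)) => //= /[!mem_sort] /mapP[i i_t ->].
  by have := allP t_s _ i_t; rewrite inE.
rewrite /G sum_ffunE (bigD1_seq u) ?subs_uniq //= big_seq_cond big1 => [|l].
  rewrite addr0 ffunE mono_sortedE ?valt' ?eqxx; [|by []|exact/eqP|by []].
  by rewrite /GRing.scale /= mulr1.
case/andP => l_s neq_lu; have [l_st sz_l _ _] := subs_sorted s_ord l_s.
by rewrite ffunE mono_sortedE ?valt' ?(negPf neq_lu) //; apply: mulr0.
Qed.

(** * Wedge products and Laplace expansion of monomials *)

Section SumPerm.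
Variables (p q : nat) (u : 'S_p) (v : 'S_q).

Definition sum_perm_fun (x : 'I_(p + q)) : 'I_(p + q) :=
  match split x with inl i => lshift q (u i) | inr j => rshift p (v j) end.

Lemma sum_perm_inj : injective sum_perm_fun.
Proof.
move=> x y; rewrite /sum_perm_fun -{2}[x]splitK -{2}[y]splitK.
case: (split x) => i; case: (split y) => j /= /eqP.
- by rewrite eq_lshift => /eqP/perm_inj->.
- by rewrite eq_lrshift.
- by rewrite eq_rlshift.
by rewrite eq_rshift => /eqP/perm_inj->.
Qed.

Definition sum_perm : 'S_(p + q) := perm sum_perm_inj.

Lemma sum_perm_l i : sum_perm (lshift q i) = lshift q (u i).
Proof. by rewrite permE /sum_perm_fun (unsplitK (inl i)). Qed.

Lemma sum_perm_r j : sum_perm (rshift p j) = rshift p (v j).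
Proof. by rewrite permE /sum_perm_fun (unsplitK (inr j)). Qed.

(** The permutation matrix of [sum_perm] is block diagonal, with the matrices of u and v as
    blocks. *)
Lemma sign_sum_perm (R : comNzRingType) : (-1) ^+ sum_perm = (-1) ^+ u * (-1) ^+ v :> R.
Proof.
rewrite -!det_perm -(det_ublock _ 0); congr (\det _).
apply/matrixP => x y; rewrite -[x]splitK -[y]splitK [LHS]mxE [LHS]mxE.
case: (split x) => i; case: (split y) => j /=;
  rewrite ?sum_perm_l ?sum_perm_r ?block_mxEul ?block_mxEur ?block_mxEdl
    ?block_mxEdr ?mxE ?eq_lrshift ?eq_rlshift //.
by rewrite eq_rshift.
Qed.
End SumPerm.

Lemma sum_Sn (V : nmodType) k (x : V) : \sum_(s : 'S_k) x = x *+ k`!.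
Proof. by rewrite sumr_const -[#|_|]/#|{: 'S_k}| card_Sn. Qed.

(** After expansion of the two smaller determinants, each pair (u, v) contributes the full
    determinant; the p! q! equal contributions cancel the binomial coefficient of [wedge] against
    the 1/(p+q)! of [alt]. *)
Lemma wedge_mono (K : numFieldType) p q (l m : seq nat) : size l = p ->
  wedge (mono K p l) (mono K q m) = mono K (p + q) (l ++ m).
Proof.
move=> sz_l; apply/ffunP => t; rewrite !ffunE scale_regE mulrA.
pose N : 'M[K]_(p + q) := \matrix_(x, y) (nth 0%N (l ++ m) x == tnth t y :> nat)%:R.
rewrite -/N.
have -> : \sum_(s : 'S_(p + q)) (-1) ^+ s *
   [ffun t0 : (p + q).-tuple 'I_10 => mono K p l [tuple tnth t0 (lshift q i) | i < p]
      * mono K q m [tuple tnth t0 (rshift p j) | j < q]] (permt t s)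
  = \sum_(u : 'S_p) \sum_(v : 'S_q) \det N.
  under eq_bigr => s _.
    rewrite !ffunE /determinant mulr_suml mulr_sumr.
    under eq_bigr => u _ do rewrite mulr_sumr mulr_sumr.
    over.
  rewrite exchange_big; apply: eq_bigr => u _ /=.
  rewrite exchange_big; apply: eq_bigr => v _ /=.
  (* Composing with the block permutation turns the Leibniz sum of [\det N] into the terms that
     belong to u and v. *)
  rewrite [RHS](reindex_inj (mulgI (sum_perm u v))) /=.
  apply: eq_bigr => s _; rewrite odd_permM signr_addb sign_sum_perm big_split_ord /=.
  under eq_bigr => i _ do rewrite !mxE !tnth_mktuple.
  under [X in _ * (_ * (_ * X))]eq_bigr => i _ do rewrite !mxE !tnth_mktuple.
  under [X in _ = _ * (X * _)]eq_bigr => i _ do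
    rewrite mxE permM sum_perm_l /= nth_cat sz_l ltn_ord.
  under [X in _ = _ * (_ * X)]eq_bigr => i _ do
    rewrite mxE permM sum_perm_r /= nth_cat sz_l ltnNge leq_addr /= addKn.
  set d := \prod_i _; set e := \prod_i _.
  by rewrite [X in _ * X]mulrACA [LHS]mulrA; congr (_ * _); rewrite mulrC.
rewrite !sum_Sn -mulrnA; move: (\det N) => x.
have nz : (p + q)`!%:R != 0 :> K by rewrite pnatr_eq0 -lt0n fact_gt0.
rewrite -[LHS]/('C(p + q, p)%:R / (p + q)`!%:R * (x *+ _) : K) -[x *+ _]mulr_natl mulrA.
rewrite -[RHS]mul1r; congr (_ * _).
rewrite mulrAC -natrM [(q`! * _)%N]mulnC.
by have := bin_fact (leq_addr q p); rewrite addKn => ->; rewrite divff.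
Qed.

(** The interior product with the a-th basis vector. *)
Definition slot (K : numFieldType) k (a : 'I_10) (T : tensor K k.+1) : tensor K k :=
  [ffun t : k.-tuple 'I_10 => T [tuple of a :: t]].

(* The terms of the Laplace expansion along the first slot: the i-th one is
   (-1) ^ i, the label l_i, and l without l_i. *)
Fixpoint cuts (l : seq nat) : seq (BinNums.Z * nat * seq nat) :=
  if l is x :: r then
    (1, x, r) :: [seq (- c.1.1, c.1.2, x :: c.2) | c <- cuts r]
  else [::].

(** Coefficients are the binary integers of Rocq, on which the kernel computes efficiently; this is
    their image in K. *)
Definition zK (K : numFieldType) (z : BinNums.Z) : K := (int_of_Z z)%:~R.

Lemma zKD (K : numFieldType) : {morph zK K : x y / x + y}.
Proof. by move=> x y; rewrite /zK rmorphD rmorphD. Qed.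
Lemma zKM (K : numFieldType) : {morph zK K : x y / x * y}.
Proof. by move=> x y; rewrite /zK rmorphM rmorphM. Qed.
Lemma zKN (K : numFieldType) : {morph zK K : x / - x}.
Proof. by move=> x; rewrite /zK rmorphN rmorphN. Qed.
Lemma zK1 (K : numFieldType) : zK K 1 = 1. Proof. by []. Qed.
Lemma zK0 (K : numFieldType) : zK K 0 = 0. Proof. by []. Qed.

Definition del (i : nat) (l : seq nat) := take i l ++ drop i.+1 l.

Lemma cutsE l : cuts l = mkseq (fun i => ((-1) ^+ i, nth 0%N l i, del i l)) (size l).
Proof.
elim: l => [|x r IHr] //=; rewrite IHr /mkseq /= -add1n iotaDl -map_comp.
congr (_ :: _); first by rewrite /del /= drop0.
by rewrite -map_comp; apply: eq_map => i /=; rewrite exprS mulN1r.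
Qed.

Lemma nth_del i l j : (i < size l)%N -> nth 0%N (del i l) j = nth 0%N l (bump i j).
Proof.
move=> lti; rewrite /del nth_cat size_take lti /bump.
case: ltnP => [ltji|leij] /=; first by rewrite nth_take.
by rewrite nth_drop addSn subnKC.
Qed.

Lemma mono_cons (K : numFieldType) k l a (t : k.-tuple 'I_10) : size l = k.+1 ->
  mono K k.+1 l [tuple of a :: t] =
  \sum_(c <- cuts l) zK K c.1.1 * (c.1.2 == a :> nat)%:R * mono K k c.2 t.
Proof.
move=> sz_l; rewrite ffunE (expand_det_col _ ord0) cutsE sz_l big_map -/(index_iota 0 k.+1) big_mkord.
apply: eq_bigr => i _; rewrite !mxE /= /cofactor addn0.
have -> : zK K ((-1) ^+ i) = (-1) ^+ i by rewrite /zK !rmorphXn !rmorphN1.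
rewrite mulrCA mulrA; congr (_ * _); rewrite ffunE; congr (\det _).
apply/matrixP => x y; rewrite !mxE nth_del ?sz_l //.
by congr (_ == _)%:R; rewrite -[lift ord0 y]/(lift ord0 y) tnthS.
Qed.

(** * Operators on formal combinations of monomials *)

(* The test a \in l only prunes the recursion early. *)
Fixpoint mono_coef (l t : seq nat) : BinNums.Z :=
  if t is a :: t' then
    if a \in l then
      foldr (fun c r => if c.1.2 == a then c.1.1 * mono_coef c.2 t' + r else r)
        0 (cuts l)
    else 0
  else 1.

Lemma cuts_size l c : c \in cuts l -> (size c.2).+1 = size l.
Proof.
rewrite cutsE /mkseq => /mapP[n]; rewrite mem_iota /= => lti -> /=.
by rewrite size_cat size_take lti size_drop -addSn subnKC.
Qed.

Lemma cuts_sub l c : c \in cuts l -> {subset c.2 <= l}.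
Proof.
rewrite cutsE /mkseq => /mapP[n]; rewrite mem_iota /= => lti -> x /=.
by rewrite mem_cat => /orP[/mem_take|/mem_drop].
Qed.

Lemma cuts_mem l c : c \in cuts l -> c.1.2 \in l.
Proof.
by rewrite cutsE /mkseq => /mapP[n]; rewrite mem_iota /= => lti ->; apply: mem_nth.
Qed.

Lemma mono_coefE (K : numFieldType) k l (t : k.-tuple 'I_10) : size l = k ->
  mono K k l t = zK K (mono_coef l (map val t)).
Proof.
elim: k l t => [|k IHk] l t sz_l; first by rewrite tuple0 ffunE det_mx00.
case/tupleP: t => a t; rewrite mono_cons // big_seq /=.
rewrite (eq_bigr (fun c : BinNums.Z * nat * seq nat =>
  zK K (if c.1.2 == a then c.1.1 * mono_coef c.2 (map val t) else 0))); last first.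
  move=> c c_l; have /eqP := cuts_size c_l; rewrite sz_l eqSS => /eqP sz_c.
  by rewrite IHk //; case: eqP => _; rewrite ?mulr0 ?mul0r ?mulr1 ?zKM.
case: ifP => [_|/negbT a_l]; last first.
  rewrite zK0 big1 // => c /cuts_mem c_l; case: eqP => // e.
  by rewrite -e c_l in a_l.
rewrite -big_seq; elim: (cuts l) => [|c s IHs]; first by rewrite big_nil.
by rewrite big_cons IHs /=; case: eqP; rewrite ?zKD // zK0 add0r.
Qed.

(* Integer combinations of monomials; on these, unlike on tensors, the operators
   can be evaluated by the kernel. *)
Definition wform := seq (BinNums.Z * seq nat).

Definition ev (K : numFieldType) k (f : wform) : tensor K k :=
  \sum_(x <- f) zK K x.1 *: mono K k x.2.

Definition wf k (s : seq nat) (f : wform) :=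
  all (fun x => (size x.2 == k) && all (fun i => i \in s) x.2) f.

Lemma wfP k s f x : wf k s f -> x \in f -> size x.2 = k /\ {subset x.2 <= s}.
Proof. by move=> /allP wff /wff /andP[/eqP ? /allP]. Qed.

Lemma ev_cat (K : numFieldType) k (f g : wform) : ev K k (f ++ g) = ev K k f + ev K k g.
Proof. exact: big_cat. Qed.

Lemma ev_Lam (K : numFieldType) k s f : wf k s f -> ev K k f \in Lam K k (inset s).
Proof.
move=> wff; rewrite /ev big_seq; apply: memv_suml => x /(wfP wff)[sz_x sub_x].
by apply: memvZ; apply: mono_Lam.
Qed.

Definition wcoef (f : wform) (t : seq nat) : BinNums.Z :=
  foldr (fun x r => x.1 * mono_coef x.2 t + r) 0 f.

Lemma wcoefE (K : numFieldType) k s f (t : k.-tuple 'I_10) : wf k s f ->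
  ev K k f t = zK K (wcoef f (map val t)).
Proof.
rewrite /ev; elim: f => [|x f IHf] /=; first by rewrite big_nil ffunE.
case/andP=> /andP[/eqP sz_x _] wff; rewrite big_cons !ffunE IHf //.
by rewrite zKD zKM -mono_coefE // ffunE.
Qed.

(** Covers repeated labels too: both monomials then vanish. *)
Lemma mono_sort (K : numFieldType) k s l : ordered s -> size l = k -> {subset l <= s} ->
  mono K k l = zK K (mono_coef l (sort leq l)) *: mono K k (sort leq l).
Proof.
(* If the component is nonzero, every column meets a label, so t is contained in m; equal sizes then
   make t the sorted version of m. *)
have only_sort t m : sorted ltn t -> size t = k -> all (fun i => i < 10)%N t -> size m = k ->
    t != sort leq m -> mono K k m (tup k t) = 0.
  move=> t_s sz_t t10 sz_m; apply: contraNeq => m_t.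
  have sub_tm : {subset t <= m}.
    move=> a /(nthP 0%N)[n ltn <-]; rewrite sz_t in ltn; apply: contraR m_t => a_m.
    rewrite ffunE (expand_det_col _ (Ordinal ltn)) big1 // => j _.
    rewrite mxE nth_valt val_tup //=; case: eqP => [e|]; last by rewrite mul0r.
    by case/negP: a_m; rewrite -e mem_nth // sz_m.
  have ut : uniq t by apply: (sorted_uniq ltn_trans ltnn t_s).
  have [_ eq_tm] := uniq_min_size ut sub_tm (eq_leq (etrans sz_m (esym sz_t))).
  have um : uniq m by rewrite (uniq_size_uniq ut eq_tm) sz_m sz_t.
  apply/eqP/(irr_sorted_eq ltn_trans ltnn) => // [|a]; last by rewrite mem_sort eq_tm.
  by rewrite ltn_sorted_uniq_leq sort_uniq um sort_sorted //; apply: leq_total.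
move=> s_ord sz_l sub_l; have sz_sl : size (sort leq l) = k by rewrite size_sort.
have us := ordered_uniq s_ord.
(* Stated for every m with the same sorted version, because it is applied both to l and to
   [sort leq l]. The [else] branch is the case of a repeated label. *)
have expand m : size m = k -> {subset m <= s} -> sort leq m = sort leq l ->
    mono K k m = (if sort leq l \in subs k s then
      zK K (mono_coef m (sort leq l)) *: mono K k (sort leq l) else 0).
  move=> sz_m sub_m eq_ml; have m_Lam := mono_Lam K sz_m sub_m.
  rewrite [LHS](Lam_expand s_ord m_Lam) big_seq.
  case: ifP => l_s.
    rewrite -big_seq (bigD1_seq (sort leq l)) ?subs_uniq //= big_seq_cond big1 ?addr0 => [|t].
      have [_ _ _ l10] := subs_sorted s_ord l_s.
      by rewrite mono_coefE // val_tup.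
    case/andP=> /(subs_sorted s_ord)[t_s sz_t _ t10] neq_t.
    by rewrite only_sort ?scale0r // eq_ml.
  rewrite big1 // => t t_in; have [t_s sz_t _ t10] := subs_sorted s_ord t_in.
  by rewrite only_sort ?scale0r // eq_ml; apply: contraFneq l_s => <-.
rewrite [LHS]expand //; case: ifP => // /negbT l_s.
rewrite [mono K k (sort leq l)]expand ?(negPf l_s) ?scaler0 //.
  by move=> i; rewrite mem_sort; apply: sub_l.
by rewrite sort_le_id // sort_sorted //; apply: leq_total.
Qed.

(* mono_coef x.2 (sort leq x.2) is the sign of the sorting permutation, or 0 if
   a label is repeated. *)
Definition std (x : BinNums.Z * seq nat) : BinNums.Z * seq nat :=
  let l := sort leq x.2 in (x.1 * mono_coef x.2 l, l).

Fixpoint insert (x : BinNums.Z * seq nat) (f : wform) : wform :=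
  if f is y :: g then
    if x.2 == y.2 then (x.1 + y.1, y.2) :: g else y :: insert x g
  else [:: x].

(** Merging equal sorted labels and dropping zero coefficients turns the vanishing of a form into
    the emptiness of a list. *)
Definition norm (f : wform) : wform :=
  [seq x <- foldr (fun x => insert (std x)) [::] f | x.1 != 0].

Lemma insert_wf k s x f : wf k s (insert x f) = wf k s (x :: f).
Proof.
rewrite /wf; elim: f => [|y g IHg] //=; case: eqP => [->|_] /=; first by rewrite andbA andbb.
by rewrite IHg /= andbCA.
Qed.

Lemma ev_insert (K : numFieldType) k x f : ev K k (insert x f) = ev K k (x :: f).
Proof.
rewrite /ev; elim: f => [|y g IHg] //=; rewrite big_cons [in RHS]big_cons.
case: eqP => [->|_]; rewrite !big_cons /= ?zKD ?scalerDl -?addrA //.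
by rewrite IHg !big_cons addrCA.
Qed.

Lemma norm_wf k s f : wf k s f -> wf k s (norm f).
Proof.
move=> wff; have: wf k s (foldr (fun x => insert (std x)) [::] f).
  elim: f wff => [|x f IHf] //= /andP[wfx /IHf wff].
  rewrite insert_wf; apply/andP; split=> //=; rewrite size_sort.
  by have /andP[-> /allP sub_x] := wfx; apply/allP => i; rewrite mem_sort => /sub_x.
by move/allP=> wfg; apply/allP => x; rewrite mem_filter => /andP[_ /wfg].
Qed.

Lemma ev_norm (K : numFieldType) k s f : ordered s -> wf k s f ->
  ev K k (norm f) = ev K k f.
Proof.
move=> s_ord wff; transitivity (ev K k (foldr (fun x => insert (std x)) [::] f)).
  rewrite /ev big_filter big_mkcond; apply: eq_bigr => x _.
  by case: eqP => //= ->; rewrite scale0r.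
elim: f wff => [|x f IHf] //= /andP[/andP[/eqP sz_x /allP sub_x] /IHf evf].
rewrite ev_insert /ev !big_cons -!/(ev _ _ _) evf; congr (_ + _).
by rewrite zKM -scalerA -(mono_sort _ s_ord).
Qed.

(** * Contractions *)

Definition ten (K : numFieldType) p q (A : tensor K p) (B : tensor K q) : tensor K (p + q) :=
  [ffun t => A [tuple tnth t (lshift q i) | i < p]
           * B [tuple tnth t (rshift p j) | j < q]].

(** The contracted slots come first because [c'.+1 + p] converts to [(c' + p).+1], so [slot] applies
    without casts. *)
Fixpoint contract (K : numFieldType) c p q : tensor K (c + p) -> tensor K (c + q) -> tensor K (p + q) :=
  match c return tensor K (c + p) -> tensor K (c + q) -> tensor K (p + q) with
  | 0 => @ten K p q
  | c'.+1 => fun A B => \sum_a @contract K c' p q (slot a A) (slot a B)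
  end.

Lemma slot_linear (K : numFieldType) k a : linear (@slot K k a).
Proof. by move=> x u v; apply/ffunP => t; rewrite !ffunE. Qed.

Lemma contract_linl (K : numFieldType) c p q (B : tensor K (c + q)) :
  linear (fun A => @contract K c p q A B).
Proof.
elim: c B => [|c IHc] B x u v /=.
  by apply/ffunP => t; rewrite !ffunE !scale_regE mulrDl mulrA.
rewrite scaler_sumr -big_split; apply: eq_bigr => a _ /=.
by rewrite slot_linear IHc.
Qed.

Lemma contract_linr (K : numFieldType) c p q (A : tensor K (c + p)) :
  linear (@contract K c p q A).
Proof.
elim: c A => [|c IHc] A x u v /=.
  by apply/ffunP => t; rewrite !ffunE !scale_regE mulrDr mulrCA.
rewrite scaler_sumr -big_split; apply: eq_bigr => a _ /=.
by rewrite slot_linear IHc.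
Qed.

Lemma linear_sum_seq (K : numFieldType) (V W : lmodType K) (f : V -> W) (I : Type)
    (r : seq I) (a : I -> K) (v : I -> V) :
  linear f -> f (\sum_(i <- r) a i *: v i) = \sum_(i <- r) a i *: f (v i).
Proof.
move=> lin_f; elim: r => [|i r IHr]; last by rewrite !big_cons lin_f IHr.
by rewrite !big_nil; have := lin_f (-1) 0 0; rewrite !scaleN1r !addNr.
Qed.

Lemma slot_mono (K : numFieldType) k l a : size l = k.+1 ->
  slot a (mono K k.+1 l) =
  \sum_(c <- cuts l) (zK K c.1.1 * (c.1.2 == a :> nat)%:R) *: mono K k c.2.
Proof.
move=> sz_l; apply/ffunP => t; rewrite ffunE mono_cons // sum_ffunE.
by apply: eq_bigr => c _; rewrite [RHS]ffunE scale_regE.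
Qed.

(* The bound y.1.2 < 10 is there because contractions range over 'I_10. *)
Fixpoint contrF c (l m : seq nat) : seq (BinNums.Z * (seq nat * seq nat)) :=
  if c is c'.+1 then
    flatten [seq flatten [seq
      if (x.1.2 == y.1.2) && (y.1.2 < 10)%N then
        [seq (x.1.1 * y.1.1 * z.1, z.2) | z <- contrF c' x.2 y.2]
      else [::] | y <- cuts m] | x <- cuts l]
  else [:: (1, (l, m))].

Lemma sum_eq_ord (K : numFieldType) n m :
  \sum_(a : 'I_10) (n == a :> nat)%:R * (m == a :> nat)%:R = ((n == m) && (m < 10)%N)%:R :> K.
Proof.
case: ltnP => [lt_m|le_m]; rewrite ?andbT ?andbF.
  rewrite (bigD1 (Ordinal lt_m)) //= eqxx mulr1 big1 ?addr0 // => a /negPf ne_a.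
  by rewrite (_ : (m == a :> nat) = false) ?mulr0 // eq_sym; apply: ne_a.
rewrite big1 // => a _; rewrite [m == _]gtn_eqF ?mulr0 //.
by apply: leq_trans le_m.
Qed.

Lemma contract_mono (K : numFieldType) c p q l m : size l = (c + p)%N -> size m = (c + q)%N ->
  contract (mono K (c + p) l) (mono K (c + q) m) =
  \sum_(z <- contrF c l m) zK K z.1 *: ten (mono K p z.2.1) (mono K q z.2.2).
Proof.
elim: c l m => [|c IHc] l m sz_l sz_m /=; first by rewrite big_seq1 scale1r.
rewrite big_flatten big_map /=.
under eq_bigr => a _.
  rewrite (slot_mono _ _ sz_l) (slot_mono _ _ sz_m).
  rewrite (linear_sum_seq _ _ _ (contract_linl _)).
  over.
rewrite exchange_big /=; apply: eq_big_seq => x x_l; rewrite big_flatten big_map /=.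
under eq_bigr => a _ do
  rewrite (linear_sum_seq _ _ _ (contract_linr _)) scaler_sumr.
rewrite exchange_big /=; apply: eq_big_seq => y y_m.
have /eqP := cuts_size x_l; rewrite sz_l eqSS => /eqP sz_x.
have /eqP := cuts_size y_m; rewrite sz_m eqSS => /eqP sz_y.
under eq_bigr => a _ do rewrite scalerA mulrACA.
rewrite -scaler_suml -mulr_sumr sum_eq_ord IHc //.
case: ifP => _; last by rewrite mulr0 scale0r big_nil.
rewrite mulr1 big_map scaler_sumr; apply: eq_bigr => z _ /=.
by rewrite scalerA !zKM.
Qed.

(* Every operator of the statement is an instance of this one: c contracted
   indices, p free indices from A and q free indices from B. *)
Definition ctr (K : numFieldType) c p q (A : tensor K (c + p)) (B : tensor K (c + q)) :=
  alt (contract A B).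

Lemma alt_ten (K : numFieldType) p q (A : tensor K p) (B : tensor K q) :
  wedge A B = 'C(p + q, p)%:R *: alt (ten A B).
Proof. by []. Qed.

(** By [wedge_mono], concatenating the uncontracted labels stands for antisymmetrization up to a
    binomial factor. With c = 0 this is the wedge product. *)
Definition opF c (A f : wform) : wform :=
  flatten [seq flatten [seq
    [seq (x.1 * y.1 * z.1, z.2.1 ++ z.2.2) | z <- contrF c x.2 y.2]
    | y <- f] | x <- A].

Lemma contrF_size c p q l m z : size l = (c + p)%N -> size m = (c + q)%N ->
  z \in contrF c l m ->
  [/\ size z.2.1 = p, size z.2.2 = q, {subset z.2.1 <= l} & {subset z.2.2 <= m}].
Proof.
elim: c l m z => [|c IHc] l m z sz_l sz_m /=.
  by rewrite inE => /eqP-> /=; split=> //; rewrite ?sz_l ?sz_m.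
case/flatten_mapP => x x_l /flatten_mapP[y y_m].
case: ifP => // _ /mapP[w w_xy -> /=].
have /eqP := cuts_size x_l; rewrite sz_l eqSS => /eqP sz_x.
have /eqP := cuts_size y_m; rewrite sz_m eqSS => /eqP sz_y.
have [-> -> sub1 sub2] := IHc _ _ _ sz_x sz_y w_xy; split=> // i.
  by move/sub1; apply: cuts_sub.
by move/sub2; apply: cuts_sub.
Qed.

Lemma opF_wf c p q s A f : wf (c + p) s A -> wf (c + q) s f -> wf (p + q) s (opF c A f).
Proof.
move=> wfA wff; apply/allP => w /flatten_mapP[x x_A /flatten_mapP[y y_f /mapP[z z_xy ->]]] /=.
have [sz_x sub_x] := wfP wfA x_A; have [sz_y sub_y] := wfP wff y_f.
have [sz1 sz2 sub1 sub2] := contrF_size sz_x sz_y z_xy.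
rewrite size_cat sz1 sz2 eqxx; apply/allP => i; rewrite mem_cat.
by case/orP => [/sub1/sub_x|/sub2/sub_y].
Qed.

(* Splitting the binomial coefficient off keeps all coefficients integral. *)
Lemma ctr_ev (K : numFieldType) c p q s A f : wf (c + p) s A -> wf (c + q) s f ->
  'C(p + q, p)%:R *: ctr (ev K (c + p) A) (ev K (c + q) f) = ev K (p + q) (opF c A f).
Proof.
move=> wfA wff; rewrite /ctr {1}/ev (linear_sum_seq _ _ _ (contract_linl _)).
rewrite (linear_sum_seq _ _ _ (@alt_is_linear K _)) scaler_sumr.
rewrite [RHS]/ev big_flatten big_map; apply: eq_big_seq => x x_A.
rewrite {1}/ev (linear_sum_seq _ _ _ (contract_linr _)).
rewrite (linear_sum_seq _ _ _ (@alt_is_linear K _)) !scaler_sumr.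
rewrite big_flatten big_map; apply: eq_big_seq => y y_f.
have [sz_x sub_x] := wfP wfA x_A; have [sz_y sub_y] := wfP wff y_f.
rewrite contract_mono // (linear_sum_seq _ _ _ (@alt_is_linear K _)) !scaler_sumr.
rewrite big_map; apply: eq_big_seq => z z_xy /=.
have [sz1 _ _ _] := contrF_size sz_x sz_y z_xy.
rewrite -wedge_mono // alt_ten !scalerA !zKM; congr (_ *: _).
by rewrite -!mulrA mulrC -!mulrA.
Qed.

(** * The operators of the statement as contractions *)

Local Ltac tuple_eq := by apply: val_inj; rewrite /= ?enum_ordSl ?enum_ord0 /= ?(tnth_nth 0).

Lemma bhatE (K : numFieldType) Th F : bhat Th F = @ctr K 3 3 1 Th F.
Proof.
congr alt; apply/ffunP => t; rewrite ffunE /= !sum_ffunE.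
apply: eq_bigr => i _; rewrite sum_ffunE; apply: eq_bigr => j _.
rewrite sum_ffunE; apply: eq_bigr => k _; rewrite !ffunE.
by congr (Th _ * F _); tuple_eq.
Qed.

Lemma b3E (K : numFieldType) Th F : b3 Th F = @ctr K 2 2 1 Th F.
Proof.
congr alt; apply/ffunP => t; rewrite ffunE /= !sum_ffunE.
apply: eq_bigr => i _; rewrite sum_ffunE; apply: eq_bigr => j _; rewrite !ffunE.
by congr (Th _ * F _); tuple_eq.
Qed.

Lemma c4E (K : numFieldType) Th F : c4 Th F = @ctr K 3 1 1 Th F.
Proof.
congr alt; apply/ffunP => t; rewrite ffunE /= !sum_ffunE.
apply: eq_bigr => i _; rewrite sum_ffunE; apply: eq_bigr => j _.
rewrite sum_ffunE; apply: eq_bigr => k _; rewrite !ffunE.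
by congr (Th _ * F _); tuple_eq.
Qed.

Lemma ctildeE (K : numFieldType) Th F : ctilde Th F = @ctr K 1 3 1 Th F.
Proof.
congr alt; apply/ffunP => t; rewrite ffunE /= !sum_ffunE.
apply: eq_bigr => i _; rewrite !ffunE.
by congr (Th _ * F _); tuple_eq.
Qed.

(* b4 contracts the last two indices of F, whereas ctr contracts the first two. *)
Lemma swap_pairs (K : numFieldType) (F : tensor K 4) a b c d :
  (forall t s, F (permt t s) = (-1) ^+ s * F t) ->
  F [tuple a; b; c; d] = F [tuple c; d; a; b].
Proof.
pose i (n : nat) : 'I_4 := inord n.
pose s := (tperm (i 0%N) (i 2%N) * tperm (i 1%N) (i 3%N))%g.
have iE n : (n < 4)%N -> i n = n :> nat by move=> ltn4; rewrite inordK.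
move=> asymF; have := asymF [tuple c; d; a; b] s.
rewrite odd_permM !odd_tperm -!(inj_eq val_inj) /= !inordK //= expr0 mul1r => <-.
congr (F _); apply: eq_from_tnth => -[x lt_x]; rewrite tnth_mktuple permM !(tnth_nth 0).
by case: x lt_x => [|[|[|[|//]]]] lt_x;
  rewrite !permE /= -!(inj_eq val_inj) /= !inordK //= !inordK.
Qed.

Lemma b4E (K : numFieldType) Th F : F \in Lam K 4 R10 -> b4 Th F = @ctr K 2 2 2 Th F.
Proof.
case/memLam=> asymF _; congr alt; apply/ffunP => t; rewrite ffunE /= !sum_ffunE.
apply: eq_bigr => i _; rewrite sum_ffunE; apply: eq_bigr => j _; rewrite !ffunE.
by rewrite (swap_pairs _ _ _ _ asymF); congr (Th _ * F _); tuple_eq.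
Qed.

(** The definition of [b2] contains no [alt]; antisymmetry is inherited from Th, whose slots are
    permuted by s on the free pair and by the identity on the contracted pair. *)
Lemma b2_antisym (K : numFieldType) (Th : tensor K 4) F t s :
  Th \in Lam K 4 R10 -> b2 Th F (permt t s) = (-1) ^+ s * b2 Th F t.
Proof.
case/memLam=> asymT _; rewrite !ffunE mulr_sumr; apply: eq_bigr => i _.
rewrite mulr_sumr; apply: eq_bigr => j _; rewrite mulrA; congr (_ * _).
pose w : 'S_4 := sum_perm s (1%g : 'S_2).
have sign_w : (-1) ^+ w = (-1) ^+ s :> K.
  by have := sign_sum_perm s (1%g : 'S_2) K; rewrite odd_perm1 mulr1.
rewrite -sign_w -asymT; congr (Th _); apply: eq_from_tnth => x; rewrite [RHS]tnth_mktuple.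
rewrite -[x](@splitK 2 2); case: (@split 2 2 x) => y /=.
  rewrite (sum_perm_l s (1%g : 'S_2) y : w _ = _) !(tnth_nth 0) /=.
  rewrite !enum_ordSl enum_ord0 /= !(tnth_nth 0).
  case: y => [[|[|//]]] lt_y /=.
    have -> : Ordinal lt_y = ord0 by apply: val_inj.
    by case: (s _) => [[|[|//]]].
  have -> : Ordinal lt_y = lift ord0 ord0 by apply: val_inj.
  by case: (s _) => [[|[|//]]].
rewrite (sum_perm_r s (1%g : 'S_2) y : w _ = _) perm1 !(tnth_nth 0) /=.
by case: y => [[|[|//]]].
Qed.

(** Antisymmetry allows [alt] to be inserted, and the symmetry of Th under exchange of its index
    pairs moves the contracted pair to the front. *)
Lemma b2E (K : numFieldType) Th F : Th \in Lam K 4 R10 -> b2 Th F = @ctr K 2 2 0 Th F.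
Proof.
move=> Th_Lam; rewrite -[LHS]alt_id //; last by move=> t s; apply: b2_antisym.
case/memLam: Th_Lam => asymT _; congr alt; apply/ffunP => t; rewrite ffunE /= !sum_ffunE.
apply: eq_bigr => i _; rewrite sum_ffunE; apply: eq_bigr => j _; rewrite !ffunE.
by rewrite (swap_pairs _ _ _ _ asymT); congr (Th _ * F _); tuple_eq.
Qed.

(** * Theta and eps as formal combinations, and operators acting on such combinations *)

Definition s2 := iota 8 2.
Definition s8 := iota 0 8.
Definition s10 := iota 0 10.

Lemma inset_s2 : inset s2 = R2.
Proof. by apply/setP => i; rewrite inE [RHS]inE mem_iota /= ltn_ord andbT. Qed.
Lemma inset_s8 : inset s8 = R8.
Proof. by apply/setP => i; rewrite inE [RHS]inE mem_iota. Qed.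
Lemma inset_s10 : inset s10 = R10.
Proof. by apply/setP => i; rewrite inE [RHS]inE mem_iota /= ltn_ord. Qed.

Definition ThF : wform := [seq (1, map predn q) | q <- map val Theta_indices].
Definition epsF : wform := [:: (1, [:: 8; 9]%N)].
Definition ThhF : wform := opF 0 ThF epsF.

(** The Leibniz formula for the transposed matrix, which is the shape of the inner sum in the
    definition of Theta. *)
Lemma mono_perm_sum (K : numFieldType) k (u t : k.-tuple 'I_10) :
  mono K k (map val u) t = \sum_(s : 'S_k) (-1) ^+ s * (t == permt u s)%:R.
Proof.
rewrite ffunE -det_tr; apply: eq_bigr => s _; congr (_ * _).
under eq_bigr => i _ do rewrite !mxE -nth_valt.
case: eqP => [->|neq_tu]; first by rewrite big1 // => i _; rewrite tnth_mktuple eqxx.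
have [i neq_i] : exists i, tnth u (s i) != tnth t i.
  apply/existsP; rewrite -negb_forall; apply/forallP => eq_tu; apply: neq_tu.
  by apply: eq_from_tnth => i; rewrite tnth_mktuple (eqP (eq_tu i)).
by rewrite (bigD1 i) //= [_ == _ :> nat](negPf neq_i) mul0r.
Qed.

Lemma map_idx k (q : k.-tuple nat) : all (fun i => i.-1 < 10)%N q ->
  map val (map_tuple idx q) = map predn q.
Proof.
move=> /allP q10; rewrite -map_comp; apply/eq_in_map => i /q10 lti.
by rewrite /= inordK.
Qed.

Lemma ThetaE (K : numFieldType) : Theta K = ev K 4 ThF.
Proof.
apply/ffunP => t; rewrite ffunE /ev sum_ffunE !big_map; apply: eq_big_seq => q q_Th.
rewrite ffunE scale_regE mul1r -map_idx ?mono_perm_sum //.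
by apply: (allP (_ : all (fun q : 4.-tuple nat => all (fun i => i.-1 < 10)%N q) Theta_indices)) q_Th.
Qed.

Lemma evecE (K : numFieldType) i : (i.-1 < 10)%N -> evec K i = mono K 1 [:: i.-1].
Proof.
move=> lti; apply/ffunP => t; have := mono_perm_sum K [tuple idx i] t.
rewrite (map_idx (q := [tuple i])) /= ?lti // => ->.
rewrite (big_pred1 1%g) => [|s]; last by apply/esym/eqP/permP => x; rewrite !ord1.
rewrite odd_perm1 mul1r ffunE; congr (t == _)%:R.
by apply: eq_from_tnth => x; rewrite !tnth_mktuple perm1.
Qed.

Lemma ev1 (K : numFieldType) k l : ev K k [:: (1, l)] = mono K k l.
Proof. by rewrite /ev big_seq1 scale1r. Qed.

Lemma epsE (K : numFieldType) : eps K = mono K 2 [:: 8; 9]%N.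
Proof. by rewrite /eps !evecE // wedge_mono. Qed.

Lemma one0E (K : numFieldType) : one0 K = mono K 0 [::].
Proof. by apply/ffunP => t; rewrite !ffunE det_mx00. Qed.

Lemma wedge_ev (K : numFieldType) p q s f g : wf p s f -> wf q s g ->
  wedge (ev K p f) (ev K q g) = ev K (p + q) (opF 0 f g).
Proof. exact: (@ctr_ev K 0 p q). Qed.

Lemma ThetaHatE (K : numFieldType) : ThetaHat K = ev K 6 ThhF.
Proof.
rewrite /ThetaHat ThetaE epsE -ev1.
by rewrite (@wedge_ev K 4 2 s10 ThF epsF).
Qed.

(** Formal combinations have integer coefficients only, so linearity over K is a separate clause: it
    carries a check on monomials over to all forms. *)
Definition rep (K : numFieldType) k k' s (O : tensor K k -> tensor K k') (OF : wform -> wform) :=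
  linear O /\ (forall f, wf k s f -> wf k' s (OF f) /\ O (ev K k f) = ev K k' (OF f)).

Definition scaleF (z : BinNums.Z) (f : wform) : wform := [seq (z * x.1, x.2) | x <- f].

Lemma ev_scale (K : numFieldType) k z f : ev K k (scaleF z f) = zK K z *: ev K k f.
Proof.
rewrite /ev big_map scaler_sumr; apply: eq_bigr => x _.
by rewrite zKM scalerA.
Qed.

Lemma wf_scale k s z f : wf k s (scaleF z f) = wf k s f.
Proof. by rewrite /wf all_map. Qed.

Definition vanishes k (s : seq nat) (OF : wform -> wform) :=
  all (fun l => nilp (norm (OF [:: (1, l)]))) (subs k s).

Section Rep.
Variables (K : numFieldType) (s : seq nat).

Lemma rep_id k : @rep K k k s id id. Proof. by []. Qed.

Lemma rep_comp k1 k2 k3 (O : tensor K k2 -> tensor K k3) OF (P : tensor K k1 -> tensor K k2) PF :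
  rep s O OF -> rep s P PF -> rep s (O \o P) (OF \o PF).
Proof.
move=> [linO repO] [linP repP]; split=> [a u v|f wff] /=; first by rewrite linP linO.
by have [wfP ->] := repP f wff; apply: repO.
Qed.

Lemma rep_scale k k' (O : tensor K k -> tensor K k') OF z :
  rep s O OF -> rep s (fun F => zK K z *: O F) (fun f => scaleF z (OF f)).
Proof.
move=> [linO repO]; split=> [a u v|f /repO[wfO ->]].
  by rewrite linO scalerDr !scalerA mulrC.
by rewrite wf_scale ev_scale.
Qed.

Lemma rep_add k k' (O P : tensor K k -> tensor K k') OF PF :
  rep s O OF -> rep s P PF -> rep s (fun F => O F + P F) (fun f => OF f ++ PF f).
Proof.
move=> [linO repO] [linP repP]; split=> [a u v|f wff].
  by rewrite linO linP scalerDr addrACA.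
have [wfO ->] := repO f wff; have [wfP ->] := repP f wff.
by split; [rewrite /wf all_cat; apply/andP | rewrite ev_cat].
Qed.

Lemma rep_norm k k' (O : tensor K k -> tensor K k') OF : ordered s ->
  rep s O OF -> rep s O (fun f => norm (OF f)).
Proof.
move=> s_ord [linO repO]; split=> // f /repO[wfO ->].
by rewrite (ev_norm _ s_ord wfO); split=> //; apply: norm_wf.
Qed.

(** Two label lists occur because an operator of R^10, such as b_hat, is tested on forms of R^8
    only. *)
Lemma rep_eq0 k k' s0 (O : tensor K k -> tensor K k') OF F :
  rep s O OF -> ordered s -> ordered s0 -> all (fun i => i \in s) s0 ->
  vanishes k s0 OF ->
  F \in Lam K k (inset s0) -> O F = 0.
Proof.
move=> [linO repO] s_ord s0_ord /allP sub0 /allP O0 F_Lam.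
rewrite (Lam_expand s0_ord F_Lam) (linear_sum_seq _ _ _ linO) big_seq big1 // => l l_s0.
have [_ sz_l sub_l _] := subs_sorted s0_ord l_s0.
have wfl : wf k s [:: (1, l)].
  by rewrite /wf /= sz_l eqxx andbT; apply/allP => i /sub_l/sub0.
have [wfO] := repO _ wfl; rewrite ev1 => ->.
by rewrite -(ev_norm _ s_ord) // (nilP (O0 _ l_s0)) /ev big_nil scaler0.
Qed.

(** Monomials and components at increasing tuples are dual to each other, so the left side is a
    trace; the right side is an integer computation. *)
Lemma rep_trace k (O : tensor K k -> tensor K k) OF : ordered s -> rep s O OF ->
  \sum_(l <- subs k s) O (mono K k l) (tup k l) =
  zK K (foldr (fun l r => wcoef (OF [:: (1, l)]) l + r) 0 (subs k s)).
Proof.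
move=> s_ord [linO repO].
suff tr r : {subset r <= subs k s} -> \sum_(l <- r) O (mono K k l) (tup k l) =
    zK K (foldr (fun l z => wcoef (OF [:: (1, l)]) l + z) 0 r) by exact: tr.
elim: r => [|l r IHr] sub_r; first by rewrite big_nil.
rewrite big_cons zKD IHr => [|m m_r]; last by rewrite sub_r // inE m_r orbT.
congr (_ + _); have l_s : l \in subs k s by rewrite sub_r ?mem_head.
have [_ sz_l /allP sub_l l10] := subs_sorted s_ord l_s.
have wfl : wf k s [:: (1, l)] by rewrite /wf /= sz_l eqxx andbT.
by have [wfO] := repO _ wfl; rewrite -ev1 => ->; rewrite (wcoefE _ _ wfO) val_tup.
Qed.

Lemma rep_ctr c p q A : wf (c + p) s A ->
  rep s (fun F => 'C(p + q, p)%:R *: @ctr K c p q (ev K (c + p) A) F) (opF c A).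
Proof.
move=> wfA; split=> [a u v|f wff].
  rewrite /ctr (contract_linr _) (alt_is_linear _) scalerDr !scalerA; congr (_ *: _ + _).
  by rewrite mulrC.
by rewrite (ctr_ev _ wfA wff); split=> //; apply: opF_wf.
Qed.

Lemma rep_wedge p q g : wf q s g ->
  rep s (fun F : tensor K p => wedge F (ev K q g)) (fun f => opF 0 f g).
Proof.
move=> wfg; split=> [a u v|f wff].
  have ten_lin : linear (fun A : tensor K p => ten A (ev K q g)) := @contract_linl K 0 p q _.
  by rewrite !alt_ten ten_lin (alt_is_linear _) scalerDr !scalerA [_ * a]mulrC.
by rewrite (wedge_ev _ wff wfg); split=> //; apply: (@opF_wf 0).
Qed.

(** Normalizing after every factor keeps uncollected terms from multiplying. *)
Fixpoint shift_prodF (OF : wform -> wform) (rs : seq BinNums.Z) (f : wform) : wform :=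
  if rs is r :: rs' then
    let g := shift_prodF OF rs' f in norm (OF g ++ scaleF (- r) g)
  else f.

(** The head of the list is the outermost factor: if [shift_prod f (b :: rs)] vanishes, the values
    of [shift_prod f rs] are b-eigenvectors. *)
Fixpoint shift_prod (V : lmodType K) (f : V -> V) (rs : seq K) (v : V) : V :=
  if rs is r :: rs' then f (shift_prod f rs' v) - r *: shift_prod f rs' v else v.

Lemma rep_shift_prod k (O : tensor K k -> tensor K k) OF rs : ordered s -> rep s O OF ->
  rep s (shift_prod O (map (zK K) rs)) (shift_prodF OF rs).
Proof.
move=> s_ord repO; elim: rs => [|r rs IHrs] /=; first exact: rep_id.
apply: rep_norm => //; apply: rep_add; first exact: (rep_comp repO IHrs).
have [linO rO] := rep_scale (- r) IHrs; split=> [a u v|f wff].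
  by have := linO a u v; rewrite zKN !scaleNr.
by have := rO f wff; rewrite zKN !scaleNr.
Qed.
End Rep.

Lemma zK_nat (K : numFieldType) n : zK K n%:R = n%:R.
Proof. by rewrite /zK !rmorph_nat. Qed.

Lemma s8_ordered : ordered s8. Proof. by []. Qed.
Lemma s10_ordered : ordered s10. Proof. by []. Qed.

Lemma ThF_wf s : {subset s8 <= s} -> wf 4 s ThF.
Proof.
move=> sub8; apply/allP => x x_Th.
have th8 : wf 4 s8 ThF by [].
have [sz_x sub_x] := wfP th8 x_Th.
by rewrite sz_x eqxx; apply/allP => i /sub_x/sub8.
Qed.

Lemma ThhF_wf : wf 6 s10 ThhF. Proof. by []. Qed.

Lemma inset_sub_R10 (K : numFieldType) k s (F : tensor K k) : F \in Lam K k (inset s) -> F \in Lam K k R10.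
Proof.
by case/memLam=> asymF _; apply/memLam; split=> // t /allPn[x]; rewrite inE.
Qed.

(** * Relations between the operators *)

Lemma c4_is_linear (K : numFieldType) (Th : tensor K 4) : linear (c4 Th).
Proof. by move=> a u v; rewrite !c4E /ctr contract_linr linearP. Qed.
HB.instance Definition _ (K : numFieldType) (Th : tensor K 4) :=
  GRing.isLinear.Build K (tensor K 4) (tensor K 2) *:%R (c4 Th) (c4_is_linear Th).

Lemma ctilde_is_linear (K : numFieldType) (Th : tensor K 4) : linear (ctilde Th).
Proof. by move=> a u v; rewrite !ctildeE /ctr contract_linr linearP. Qed.
HB.instance Definition _ (K : numFieldType) (Th : tensor K 4) :=
  GRing.isLinear.Build K (tensor K 2) (tensor K 4) *:%R (ctilde Th) (ctilde_is_linear Th).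

Lemma wedge_linl (K : numFieldType) p q (B : tensor K q) : linear (fun A : tensor K p => wedge A B).
Proof.
have ten_lin : linear (fun A : tensor K p => ten A B) := @contract_linl K 0 p q _.
by move=> a u v; rewrite !alt_ten ten_lin linearP scalerDr !scalerA mulrC.
Qed.

Lemma wedge_linr (K : numFieldType) p q (A : tensor K p) : linear (wedge A : tensor K q -> _).
Proof.
have ten_lin : linear (ten A : tensor K q -> _) := @contract_linr K 0 p q _.
by move=> a u v; rewrite !alt_ten ten_lin linearP scalerDr !scalerA mulrC.
Qed.

HB.instance Definition _ (K : numFieldType) p q (A : tensor K p) :=
  GRing.isLinear.Build K (tensor K q) (tensor K (p + q)) *:%R (wedge A) (@wedge_linr K p q A).

Lemma wedgeZl (K : numFieldType) p q a (A : tensor K p) (B : tensor K q) :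
  wedge (a *: A) B = a *: wedge A B.
Proof.
have := linear_sum_seq [:: tt] (fun=> a) (fun=> A) (wedge_linl B).
by rewrite !big_seq1.
Qed.

Section Representations.
Variable K : numFieldType.
Notation Th := (Theta K).

Lemma rep_ext s k k' (O P : tensor K k -> tensor K k') OF : rep s P OF ->
  linear O -> (forall F, F \in Lam K k (inset s) -> O F = P F) -> rep s O OF.
Proof.
move=> [_ repP] linO eqOP; split=> // f wff; have [wfO <-] := repP f wff.
by split=> //; apply/eqOP/ev_Lam.
Qed.

Variable s : seq nat.
Hypothesis sub8 : {subset s8 <= s}.

Lemma linear_scale k k' (O : {linear tensor K k -> tensor K k'}) (c : K) :
  linear (fun F => c *: O F).
Proof. by move=> a u v; rewrite linearP scalerDr !scalerA mulrC. Qed.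

Let Th_Lam : Th \in Lam K 4 R10.
Proof. by rewrite ThetaE (inset_sub_R10 (ev_Lam _ (ThF_wf sub8))). Qed.

Lemma rep_b2 : rep s (b2 Th) (opF 2 ThF).
Proof.
apply: (rep_ext (@rep_ctr K s 2 2 0 _ (ThF_wf sub8))); first exact: linearP.
by move=> F _; rewrite (b2E _ Th_Lam) -ThetaE scale1r.
Qed.

(** The factor 3 here, and 6, 2 and 4 for b4, c and ctilde, are the binomials ['C(p + q, p)] of
    [ctr_ev] for p = 2, 2, 1, 3 free indices of Theta and q = 1, 2, 1, 1 of F. *)
Lemma rep_b3 : rep s (fun F => 3 *: b3 Th F) (opF 2 ThF).
Proof.
apply: (rep_ext (@rep_ctr K s 2 2 1 _ (ThF_wf sub8))); first exact: linear_scale.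
by move=> F _; rewrite b3E -ThetaE.
Qed.

Lemma rep_b4 : rep s (fun F => 6 *: b4 Th F) (opF 2 ThF).
Proof.
apply: (rep_ext (@rep_ctr K s 2 2 2 _ (ThF_wf sub8))); first exact: linear_scale.
by move=> F /inset_sub_R10 F_Lam; rewrite b4E // -ThetaE.
Qed.

Lemma rep_c4 : rep s (fun F => 2 *: c4 Th F) (opF 3 ThF).
Proof.
have [lin_c rep_c] := @rep_ctr K s 3 1 1 _ (ThF_wf sub8).
split=> [a u v|f wff]; first by have := lin_c a u v; rewrite -ThetaE !c4E.
by have [wf_c <-] := rep_c f wff; rewrite c4E -ThetaE.
Qed.

Lemma rep_ctilde : rep s (fun F => 4 *: ctilde Th F) (opF 1 ThF).
Proof.
have [lin_c rep_c] := @rep_ctr K s 1 3 1 _ (ThF_wf sub8).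
split=> [a u v|f wff]; first by have := lin_c a u v; rewrite -ThetaE !ctildeE.
by have [wf_c <-] := rep_c f wff; rewrite ctildeE -ThetaE.
Qed.

End Representations.

Section Identities.
Variable K : numFieldType.
Notation Th := (Theta K).
Notation bh := (bhat (ThetaHat K)).

Lemma sub8_10 : {subset s8 <= s10}.
Proof. by apply/allP. Qed.
Let sub88 : {subset s8 <= s8}. Proof. by []. Qed.

Lemma rep_bhat : rep s10 (fun F => 4 *: bh F) (opF 3 ThhF).
Proof.
apply: (rep_ext (@rep_ctr K s10 3 3 1 _ ThhF_wf)); first exact: linear_scale.
by move=> F _; rewrite bhatE -ThetaHatE.
Qed.

Lemma solve_lin (V : lmodType K) (a b c : K) (u v : V) :
  a != 0 -> c = - (b / a) -> a *: u + b *: v = 0 -> u = c *: v.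
Proof.
move=> nz_a -> /eqP; rewrite addr_eq0 => /eqP e.
by apply: (scalerI nz_a); rewrite e scalerA mulrN mulrCA mulfV // mulr1 scaleNr.
Qed.

Ltac solve_with := apply: solve_lin; [by rewrite -?natrM pnatr_eq0 | by field].

Lemma c4_b4 F : F \in Lam K 4 R8 -> c4 Th (b4 Th F) = - 2 *: c4 Th F.
Proof.
(* This stands for (2 c) (6 b4) + 12 (2 c), that is 12 (c b4 + 2 c). *)
pose OF f := opF 3 ThF (norm (opF 2 ThF f)) ++ scaleF 12%:R (opF 3 ThF f).
have rep_OF := rep_add (rep_comp (rep_c4 K sub88) (rep_norm s8_ordered (rep_b4 K sub88)))
   (rep_scale 12%:R (rep_c4 K sub88)).
(* The check on the 70 monomials of degree 4; [vm_cast_no_check] leaves the evaluation to the kernel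
   at [Qed]. *)
have vanish_OF : vanishes 4 s8 OF by vm_cast_no_check (erefl true).
rewrite -inset_s8 => /(rep_eq0 rep_OF s8_ordered s8_ordered isT vanish_OF) /= {rep_OF vanish_OF}.
rewrite zK_nat linearZ !scalerA; solve_with.
Qed.

Lemma ctilde_b2 F : F \in Lam K 2 R8 -> ctilde Th (b2 Th F) = - 6 *: ctilde Th F.
Proof.
pose OF f := opF 1 ThF (norm (opF 2 ThF f)) ++ scaleF 6%:R (opF 1 ThF f).
have rep_OF := rep_add (rep_comp (rep_ctilde K sub88) (rep_norm s8_ordered (rep_b2 K sub88)))
   (rep_scale 6%:R (rep_ctilde K sub88)).
have vanish_OF : vanishes 2 s8 OF by vm_cast_no_check (erefl true).
rewrite -inset_s8 => /(rep_eq0 rep_OF s8_ordered s8_ordered isT vanish_OF) /= {rep_OF vanish_OF}.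
rewrite zK_nat !scalerA; solve_with.
Qed.

Lemma c4_ctilde F : F \in Lam K 2 R8 -> c4 Th (ctilde Th F) = 3 *: b2 Th F - 6 *: F.
Proof.
(* This stands for (2 c) (4 ctilde) - (24 b2 - 48), that is 8 times the claimed relation. *)
pose OF f := opF 3 ThF (norm (opF 1 ThF f)) ++
  scaleF (- 1) (scaleF 24%:R (opF 2 ThF f) ++ scaleF (- 48%:R) f).
have rep_OF := rep_add (rep_comp (rep_c4 K sub88) (rep_norm s8_ordered (rep_ctilde K sub88)))
   (rep_scale (-1) (rep_add (rep_scale 24%:R (rep_b2 K sub88)) (rep_scale (- 48%:R) (rep_id K s8 2)))).
have vanish_OF : vanishes 2 s8 OF by vm_cast_no_check (erefl true).
rewrite -inset_s8 => /(rep_eq0 rep_OF s8_ordered s8_ordered isT vanish_OF) /= {rep_OF vanish_OF}.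
rewrite !zKN zK1 !zK_nat linearZ !scalerA -natrM scaleN1r => /eqP.
rewrite subr_eq0 => /eqP H; apply: (@scalerI _ _ (2 * 4)%:R); rewrite ?pnatr_eq0 // H.
by rewrite scalerBr !scalerA -!natrM scaleNr.
Qed.

Lemma bhat_Lam4_R8 F : F \in Lam K 4 R8 -> bh F = 2^-1 *: wedge (c4 Th F) (eps K).
Proof.
(* 4 b_hat is compared with the wedge of 2 c and eps, whence the factor 1/2. *)
pose OF f := opF 3 ThhF f ++ scaleF (- 1) (opF 0 (opF 3 ThF f) epsF).
have eps_wf : wf 2 s10 epsF by [].
have rep_OF := rep_add rep_bhat
   (rep_scale (- 1) (rep_comp (rep_wedge K 2 eps_wf) (rep_c4 K sub8_10))).
have vanish_OF : vanishes 4 s8 OF by vm_cast_no_check (erefl true).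
rewrite -inset_s8 => /(rep_eq0 rep_OF s10_ordered s8_ordered isT vanish_OF) /= {rep_OF vanish_OF}.
rewrite zKN zK1 ev1 -epsE wedgeZl !scalerA; solve_with.
Qed.

Lemma bhat_eps F : F \in Lam K 2 R8 -> bh (wedge F (eps K)) = 6 *: ctilde Th F.
Proof.
pose OF f := opF 3 ThhF (opF 0 f epsF) ++ scaleF (- 6%:R) (opF 1 ThF f).
have eps_wf : wf 2 s10 epsF by [].
have rep_OF := rep_add (rep_comp rep_bhat (rep_wedge K 2 eps_wf))
   (rep_scale (- 6%:R) (rep_ctilde K sub8_10)).
have vanish_OF : vanishes 2 s8 OF by vm_cast_no_check (erefl true).
rewrite -inset_s8 => /(rep_eq0 rep_OF s10_ordered s8_ordered isT vanish_OF) /= {rep_OF vanish_OF}.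
rewrite zKN zK_nat ev1 -epsE !scalerA; solve_with.
Qed.

Lemma bhat_e9 F : F \in Lam K 3 R8 ->
  bh (wedge F (evec K 9)) = 9 / 4 *: wedge (b3 Th F) (evec K 10).
Proof.
(* 4 b_hat is compared with 3 (3 b3), whence 9/4. The labels 8 and 9 are e_9 and e_10. *)
pose OF f := opF 3 ThhF (opF 0 f [:: (1, [:: 8%N])]) ++
  scaleF (- 3%:R) (opF 0 (opF 2 ThF f) [:: (1, [:: 9%N])]).
have [e9_wf e10_wf] : wf 1 s10 [:: (1, [:: 8%N])] /\ wf 1 s10 [:: (1, [:: 9%N])] by [].
have rep_OF := rep_add (rep_comp rep_bhat (rep_wedge K 3 e9_wf))
   (rep_scale (- 3%:R) (rep_comp (rep_wedge K 3 e10_wf) (rep_b3 K sub8_10))).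
have vanish_OF : vanishes 3 s8 OF by vm_cast_no_check (erefl true).
rewrite -inset_s8 => /(rep_eq0 rep_OF s10_ordered s8_ordered isT vanish_OF) /= {rep_OF vanish_OF}.
rewrite zKN zK_nat !ev1 -(@evecE K 9) // -(@evecE K 10) // wedgeZl !scalerA; solve_with.
Qed.

Lemma bhat_e10 F : F \in Lam K 3 R8 ->
  bh (wedge F (evec K 10)) = - (9 / 4) *: wedge (b3 Th F) (evec K 9).
Proof.
pose OF f := opF 3 ThhF (opF 0 f [:: (1, [:: 9%N])]) ++
  scaleF 3%:R (opF 0 (opF 2 ThF f) [:: (1, [:: 8%N])]).
have [e9_wf e10_wf] : wf 1 s10 [:: (1, [:: 8%N])] /\ wf 1 s10 [:: (1, [:: 9%N])] by [].
have rep_OF := rep_add (rep_comp rep_bhat (rep_wedge K 3 e10_wf))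
   (rep_scale 3%:R (rep_comp (rep_wedge K 3 e9_wf) (rep_b3 K sub8_10))).
have vanish_OF : vanishes 3 s8 OF by vm_cast_no_check (erefl true).
rewrite -inset_s8 => /(rep_eq0 rep_OF s10_ordered s8_ordered isT vanish_OF) /= {rep_OF vanish_OF}.
rewrite zK_nat !ev1 -(@evecE K 9) // -(@evecE K 10) // wedgeZl !scalerA; solve_with.
Qed.

Lemma b2_shift_prod F : F \in Lam K 2 R8 -> shift_prod (b2 Th) [:: 2; - 6] F = 0.
Proof.
pose rs : seq BinNums.Z := [:: 2%:R; - 6%:R].
have rep_OF := rep_shift_prod rs s8_ordered (rep_b2 K sub88).
have vanish_OF : vanishes 2 s8 (shift_prodF (opF 2 ThF) rs) by vm_cast_no_check (erefl true).
rewrite -inset_s8 => /(rep_eq0 rep_OF s8_ordered s8_ordered isT vanish_OF) {rep_OF vanish_OF}.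
by rewrite /= zKN !zK_nat.
Qed.

(** The roots are 3 times the eigenvalues 2/3 and -4. *)
Lemma b3_shift_prod F : F \in Lam K 3 R8 -> shift_prod (fun F => 3 *: b3 Th F) [:: 2; - 12] F = 0.
Proof.
pose rs : seq BinNums.Z := [:: 2%:R; - 12%:R].
have rep_OF := rep_shift_prod rs s8_ordered (rep_b3 K sub88).
have vanish_OF : vanishes 3 s8 (shift_prodF (opF 2 ThF) rs) by vm_cast_no_check (erefl true).
rewrite -inset_s8 => /(rep_eq0 rep_OF s8_ordered s8_ordered isT vanish_OF) {rep_OF vanish_OF}.
by rewrite /= zKN !zK_nat.
Qed.

(** The roots are 6 times 0, -4, 2/3 and -2. *)
Lemma b4_shift_prod F : F \in Lam K 4 R8 -> shift_prod (fun F => 6 *: b4 Th F) [:: 0; - 24; 4; - 12] F = 0.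
Proof.
pose rs : seq BinNums.Z := [:: 0; - 24%:R; 4%:R; - 12%:R].
have rep_OF := rep_shift_prod rs s8_ordered (rep_b4 K sub88).
have vanish_OF : vanishes 4 s8 (shift_prodF (opF 2 ThF) rs) by vm_cast_no_check (erefl true).
rewrite -inset_s8 => /(rep_eq0 rep_OF s8_ordered s8_ordered isT vanish_OF) {rep_OF vanish_OF}.
by rewrite /= !zKN !zK_nat.
Qed.

End Identities.

(** * Dimensions of eigenspaces as traces *)

Section Trace.
Variables (K : fieldType) (vT : vectType K).
Implicit Types (U V W : {vspace vT}).

(* n and m are both the dimension of U, but need not be convertible. *)
Lemma trace_basis n m (X : n.-tuple vT) (Y : m.-tuple vT) U (f : {linear vT -> vT}) :
  basis_of U X -> basis_of U Y -> (forall u, u \in U -> f u \in U) ->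
  \sum_i coord X i (f X`_i) = \sum_j coord Y j (f Y`_j).
Proof.
move=> bX bY fU.
have expand p (Z : p.-tuple vT) u : basis_of U Z -> u \in U -> u = \sum_i coord Z i u *: Z`_i.
  by move=> bZ; rewrite -{1}(span_basis bZ) => /coord_span.
have memX (i : 'I_n) : X`_i \in U by apply: (basis_mem bX); rewrite mem_nth ?size_tuple.
have memY (j : 'I_m) : Y`_j \in U by apply: (basis_mem bY); rewrite mem_nth ?size_tuple.
(* Both traces equal this double sum: on the left the X_i are expanded in Y, on the right the f Y_j
   in X. *)
transitivity (\sum_(i < n) \sum_(j < m) coord Y j X`_i * coord X i (f Y`_j)).
  apply: eq_bigr => i _; rewrite {1}(expand _ Y _ bY (memX i)) !linear_sum.
  by apply: eq_bigr => j _; rewrite !linearZ.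
rewrite exchange_big; apply: eq_bigr => j _ /=.
rewrite [in RHS](expand _ X _ bX (fU _ (memY j))) linear_sum.
by apply: eq_bigr => i _; rewrite linearZ /= mulrC.
Qed.

Lemma eigP k (KK : numFieldType) (U : {vspace tensor KK k}) f (a : KK) x :
  x \in eig U f a <-> x \in U /\ f x = a *: x.
Proof.
rewrite memv_cap memv_ker add_lfunE opp_lfunE scale_lfunE id_lfunE lfunE subr_eq0.
by split=> [/andP[-> /eqP]|[-> /eqP]].
Qed.

(* U is the direct sum of W, where q is the homothety c, and of ker q. *)
Lemma trace_projection U W (q : {linear vT -> vT}) (c : K) n (X : n.-tuple vT) :
  basis_of U X -> (W <= U)%VS -> c != 0 ->
  (forall u, u \in U -> q u \in W) -> (forall w, w \in W -> q w = c *: w) ->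
  \sum_i coord X i (q X`_i) = c * (\dim W)%:R.
Proof.
move=> bX sWU nz_c qU qW; pose N := (U :&: lker (linfun q))%VS.
have WN0 : (W :&: N = 0)%VS.
  apply/eqP; rewrite -subv0; apply/subvP => w; rewrite !memv_cap memv_ker lfunE /=.
  case/and3P=> w_W _; rewrite qW // scaler_eq0 (negPf nz_c) /= => /eqP->.
  exact: mem0v.
have U_WN : (W + N)%VS = U.
  apply/eqP; rewrite eqEsubv subv_add sWU capvSl /=; apply/subvP => u u_U.
  (* The first summand q u / c lies in W, where q is c, so q kills the remainder. *)
  rewrite -[u](subrKC (c^-1 *: q u)) memv_add ?memvZ ?qU //.
  rewrite memv_cap memv_ker lfunE /=; have -> : q (u - c^-1 *: q u) = 0.
    by rewrite raddfB /= linearZZ (qW (q u)) ?qU // scalerA mulVf // scale1r subrr.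
  rewrite eqxx andbT.
  by rewrite rpredB // rpredZ // (subvP sWU) ?qU.
(* In a basis adapted to W + N the map q is diagonal, with entries c on W and 0 on N. *)
pose Y := cat_tuple (vbasis W) (vbasis N).
have bY : basis_of U Y.
  by rewrite -U_WN cat_basis ?vbasisP //; apply/directv_addP.
have free_Y := basis_free bY.
rewrite (trace_basis bX bY) => [|u /qU /(subvP sWU) //].
rewrite big_split_ord /= [X in _ + X]big1 ?addr0 => [|j _].
  rewrite (eq_bigr (fun=> c)) => [|i _]; first by rewrite sumr_const card_ord mulr_natr.
  have -> : (vbasis W ++ vbasis N)`_i = Y`_(lshift (\dim N) i) by [].
  rewrite qW; last by rewrite nth_cat size_tuple /= ltn_ord vbasis_mem // mem_nth ?size_tuple.
  transitivity (c * coord Y (lshift (\dim N) i) Y`_(lshift (\dim N) i)); first exact: linearZ.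
  by rewrite coord_free // eqxx mulr1.
suff -> : q (vbasis W ++ vbasis N)`_(\dim W + j) = 0 by rewrite linear0.
have : (vbasis N)`_j \in N by rewrite vbasis_mem // mem_nth ?size_tuple.
rewrite memv_cap memv_ker lfunE => /andP[_ /eqP] /=.
by rewrite nth_cat size_tuple ltnNge leq_addr /= addKn.
Qed.

End Trace.

Lemma shift_prod_linear (K : numFieldType) (V : lmodType K) (f : {linear V -> V}) rs :
  linear (shift_prod f rs).
Proof.
elim: rs => [|r rs IHrs] a u v //=; rewrite IHrs linearP !scalerDr scalerN !scalerA.
by rewrite [r * a]mulrC opprD addrACA.
Qed.
HB.instance Definition _ (K : numFieldType) (V : lmodType K) (f : {linear V -> V}) rs :=
  GRing.isLinear.Build K V V *:%R (shift_prod f rs) (shift_prod_linear f rs).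

Lemma shift_prod_eigen (K : numFieldType) (V : lmodType K) (f : {linear V -> V}) rs a x :
  f x = a *: x -> shift_prod f rs x = (\prod_(r <- rs) (a - r)) *: x.
Proof.
move=> fx; elim: rs => [|r rs IHrs] /=; first by rewrite big_nil scale1r.
by rewrite big_cons IHrs linearZ /= fx !scalerA -scalerBl mulrC -mulrBl.
Qed.

Lemma mono_tup (K : numFieldType) k s l m : ordered s -> l \in subs k s -> m \in subs k s ->
  mono K k l (tup k m) = (l == m)%:R.
Proof.
move=> s_ord /(subs_sorted s_ord)[l_s sz_l _ _] /(subs_sorted s_ord)[m_s sz_m _ m10].
by rewrite mono_sortedE ?val_tup.
Qed.

Lemma mono_basis (K : numFieldType) k s : ordered s ->
  basis_of (Lam K k (inset s)) [seq mono K k l | l <- subs k s].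
Proof.
move=> s_ord; have us := ordered_uniq s_ord.
set X := map _ _; apply/andP; split.
  rewrite eqEsubv; apply/andP; split.
    apply/span_subvP => _ /mapP[l /(subs_sorted s_ord)[_ sz_l sub_l _] ->].
    exact: mono_Lam.
  apply/subvP => F /(Lam_expand s_ord) ->; rewrite big_seq; apply: memv_suml => l l_s.
  by rewrite rpredZ // memv_span // map_f.
rewrite -[X]/(tval (in_tuple X)); apply/freeP => a sum0 i.
have lt_i : (i < size (subs k s))%N by rewrite -(size_map (mono K k)).
have := congr1 (fun F : tensor K k => F (tup k (nth [::] (subs k s) i))) sum0.
rewrite sum_ffunE (bigD1 i) //= big1 => [|j neq_ji].
  rewrite addr0 !ffunE /= (nth_map [::]) // scale_regE (mono_tup _ s_ord) ?mem_nth //.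
  by rewrite eqxx mulr1.
have lt_j : (j < size (subs k s))%N by rewrite -(size_map (mono K k)).
rewrite !ffunE (nth_map [::]) // scale_regE (mono_tup _ s_ord) ?mem_nth //.
by rewrite nth_uniq ?subs_uniq // (inj_eq val_inj) (negPf neq_ji) mulr0.
Qed.

Lemma coord_mono (K : numFieldType) k s F i : ordered s -> F \in Lam K k (inset s) ->
  coord (in_tuple [seq mono K k l | l <- subs k s]) i F = F (tup k (nth [::] (subs k s) i)).
Proof.
move=> s_ord F_Lam; set X := in_tuple _.
have free_X : free X by apply: basis_free (mono_basis K k s_ord).
have us := ordered_uniq s_ord.
have lt_i : (i < size (subs k s))%N by rewrite -(size_map (mono K k)).
rewrite {1}(Lam_expand s_ord F_Lam) linear_sum (bigD1_seq (nth [::] (subs k s) i)) ?mem_nth ?subs_uniq //=.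
have Xi (j : 'I_(size X)) : mono K k (nth [::] (subs k s) j) = X`_j.
  by rewrite (nth_map [::]) // -(size_map (mono K k)).
rewrite linearZ /= Xi coord_free // eqxx mulr1 big_seq_cond big1 ?addr0 // => l /andP[l_s neq_l].
have lt_l : (index l (subs k s) < size X)%N by rewrite size_map index_mem.
rewrite linearZ /= -[l](nth_index [::] l_s) (Xi (Ordinal lt_l)) coord_free //.
case: eqP => [e|]; last by rewrite mulr0.
by rewrite -e /= nth_index ?eqxx in neq_l.
Qed.

(* The product of the f - r over the other eigenvalues r is a multiple of the
   projection onto the b-eigenspace. *)
Lemma eig_dim (K : numFieldType) k s (f : {linear tensor K k -> tensor K k}) b rs :
  ordered s -> (forall F, F \in Lam K k (inset s) -> f F \in Lam K k (inset s)) ->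
  (forall F, F \in Lam K k (inset s) -> shift_prod f (b :: rs) F = 0) ->
  b \notin rs ->
  \sum_(l <- subs k s) shift_prod f rs (mono K k l) (tup k l) =
  (\prod_(r <- rs) (b - r)) * (\dim (eig (Lam K k (inset s)) f b))%:R.
Proof.
move=> s_ord stable kill b_rs.
have stableq F : F \in Lam K k (inset s) -> shift_prod f rs F \in Lam K k (inset s).
  by move=> F_Lam; elim: (rs) => //= r t IHt; rewrite rpredB ?rpredZ ?stable.
have nz : \prod_(r <- rs) (b - r) != 0.
  rewrite prodf_seq_neq0; apply/allP => r r_rs /=; rewrite subr_eq0.
  by apply: contraNneq b_rs => ->.
have bX : basis_of (Lam K k (inset s)) (in_tuple [seq mono K k l | l <- subs k s]).
  exact: mono_basis.
have sWU : (eig (Lam K k (inset s)) f b <= Lam K k (inset s))%VS by apply: capvSl.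
have qW F : F \in Lam K k (inset s) -> shift_prod f rs F \in eig (Lam K k (inset s)) f b.
  move=> F_Lam; apply/eigP; split; first exact: stableq.
  by apply/eqP; rewrite -subr_eq0; apply/eqP/kill.
have qc F : F \in eig (Lam K k (inset s)) f b ->
    shift_prod f rs F = (\prod_(r <- rs) (b - r)) *: F.
  by case/eigP=> _ /shift_prod_eigen.
apply: etrans (trace_projection bX sWU nz qW qc).
rewrite (big_nth [::]) big_mkord -(size_map (mono K k)); apply: eq_bigr => i _.
have lt_i : (i < size (subs k s))%N by rewrite -(size_map (mono K k)).
rewrite coord_mono // (nth_map [::]) // stableq //.
by have [_ sz_l sub_l _] := subs_sorted s_ord (mem_nth [::] lt_i); apply: mono_Lam.
Qed.

(** The factors f - r commute, so the root b can be moved to the outermost place, where [eig_dim]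
    expects it. *)
Lemma shift_prod_rem (K : numFieldType) (V : lmodType K) (f : {linear V -> V}) b rs x :
  b \in rs -> shift_prod f rs x = shift_prod f (b :: rem b rs) x.
Proof.
have expand a c y : f (f y - a *: y) - c *: (f y - a *: y) = f (f y) - (a + c) *: f y + (c * a) *: y.
  by rewrite raddfB /= linearZZ scalerBr scalerA opprB scalerDl opprD addrA addrAC addrA.
elim: rs => // r rs IHrs; rewrite inE /= eq_sym; case: eqP => [->|_] //= /IHrs ->/=.
by rewrite !expand addrC [b + r]addrC [r * b]mulrC addrC.
Qed.

Lemma rep_Lam (K : numFieldType) s k k' (O : tensor K k -> tensor K k') OF F :
  ordered s -> rep s O OF -> F \in Lam K k (inset s) -> O F \in Lam K k' (inset s).
Proof.
move=> s_ord [linO repO] F_Lam.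
rewrite (Lam_expand s_ord F_Lam) (linear_sum_seq _ _ _ linO) big_seq.
apply: memv_suml => l /(subs_sorted s_ord)[_ sz_l sub_l _].
have wfl : wf k s [:: (1, l)] by rewrite /wf /= sz_l eqxx andbT; apply/allP.
by apply: memvZ; have [wfO] := repO _ wfl; rewrite ev1 => ->; apply: ev_Lam.
Qed.

Lemma zK_inj (K : numFieldType) : injective (zK K).
Proof. by move=> x y /intr_inj/(can_inj int_of_ZK). Qed.

Definition trF k s (OF : wform -> wform) : BinNums.Z :=
  foldr (fun l r => wcoef (OF [:: (1, l)]) l + r) 0 (subs k s).

(** The scalar by which the product of the factors f - r acts on the b-eigenspace. *)
Definition prodZ (b : BinNums.Z) rs : BinNums.Z := foldr (fun r z => (b - r) * z) 1 rs.

(* The factor n + 1 clears the denominators of f. *)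
Lemma dim_eig_rep (K : numFieldType) k s n OF (f : {linear tensor K k -> tensor K k}) rs b d :
  ordered s -> rep s (fun F => n.+1%:R *: f F) OF ->
  (forall F, F \in Lam K k (inset s) -> shift_prod (fun F => n.+1%:R *: f F) (map (zK K) rs) F = 0) ->
  uniq rs -> b \in rs ->
  trF k s (shift_prodF OF (rem b rs)) == prodZ b (rem b rs) * d%:R ->
  \dim (eig (Lam K k (inset s)) f (zK K b / n.+1%:R)) = d.
Proof.
move=> s_ord rep_f kill u_rs b_rs /eqP tr_f.
pose g : {linear tensor K k -> tensor K k} := n.+1%:R \*: f.
have nz : n.+1%:R != 0 :> K by rewrite pnatr_eq0.
have -> : eig (Lam K k (inset s)) f (zK K b / n.+1%:R) = eig (Lam K k (inset s)) g (zK K b).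
  apply/vspaceP => F; apply/idP/idP => /eigP[F_Lam eF]; apply/eigP; split=> //.
    by rewrite /g /= eF scalerA mulrC divfK.
  by apply: (scalerI nz); rewrite scalerA mulrC divfK // -eF.
have := eig_dim (f := g) (b := zK K b) (rs := map (zK K) (rem b rs)) s_ord.
rewrite (rep_trace s_ord (rep_shift_prod (rem b rs) s_ord rep_f)) -/(trF _ _ _) tr_f.
have zb_rs : zK K b \in map (zK K) rs by apply: map_f.
have -> : \prod_(r <- map (zK K) (rem b rs)) (zK K b - r) = zK K (prodZ b (rem b rs)).
  elim: (rem b rs) => [|r t IHt]; first by rewrite big_nil.
  by rewrite big_cons IHt /= zKM zKD zKN.
have rem_map : map (zK K) (rem b rs) = rem (zK K b) (map (zK K) rs).
  elim: (rs) => //= r t IHt; rewrite (inj_eq (@zK_inj K)).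
  by case: eqP => //= _; rewrite IHt.
rewrite zKM zK_nat => H; apply/eqP; rewrite eq_sym -(eqr_nat K); apply/eqP.
(* The trace is this scalar times d by computation and times the dimension by [eig_dim]; as the
   roots are distinct it can be cancelled. *)
have nzP : zK K (prodZ b (rem b rs)) != 0.
  rewrite -(zK0 K) (inj_eq (@zK_inj K)).
  have : b \notin rem b rs by rewrite mem_rem_uniqF.
  elim: (rem b rs) => [|r t IHt] //; rewrite inE negb_or => /andP[neq_br /IHt].
  by rewrite /= mulf_eq0 negb_or subr_eq0 neq_br.
apply: (mulfI nzP); apply: H.
- by move=> F; apply: (rep_Lam s_ord rep_f).
- by move=> F F_Lam; rewrite rem_map -shift_prod_rem //; apply: kill.
by rewrite rem_map mem_rem_uniqF // map_inj_uniq //; apply: zK_inj.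
Qed.

Section Dims.
Variable K : numFieldType.
Let sub88 : {subset s8 <= s8}. Proof. by []. Qed.

Let rs2 : seq BinNums.Z := [:: 2%:R; - 6%:R].
Let rs3 : seq BinNums.Z := [:: 2%:R; - 12%:R].
Let rs4 : seq BinNums.Z := [:: 0; - 24%:R; 4%:R; - 12%:R].

Let rep_b2' : rep s8 (fun F => 1%:R *: b2 (Theta K) F) (opF 2 ThF).
Proof.
by apply: (rep_ext (rep_b2 K sub88)) => [|F _]; [apply: linear_scale | rewrite scale1r].
Qed.

Lemma dim_Lam2_2 : \dim (Lam2_ (2 : K)) = 21%N.
Proof.
rewrite /Lam2_ -inset_s8 -[2](zK_nat K) -[zK K 2%:R]divr1.
apply: (dim_eig_rep s8_ordered rep_b2') (isT : uniq rs2) _ _; last first.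
- by vm_cast_no_check (erefl true).
- by [].
move=> F; rewrite inset_s8 => /b2_shift_prod; rewrite /rs2 /= zKN !zK_nat => e.
by rewrite !scale1r.
Qed.

Lemma dim_Lam2_m6 : \dim (Lam2_ (- 6 : K)) = 7%N.
Proof.
have -> : - 6 = zK K (- 6%:R) / 1%:R by rewrite ?zKN ?zK0 ?zK_nat; field.
rewrite /Lam2_ -inset_s8.
apply: (dim_eig_rep s8_ordered rep_b2') (isT : uniq rs2) _ _; last first.
- by vm_cast_no_check (erefl true).
- by [].
move=> F; rewrite inset_s8 => /b2_shift_prod; rewrite /rs2 /= !zKN !zK_nat => e.
by rewrite !scale1r.
Qed.

Lemma dim_Lam3_m4 : \dim (Lam3_ (- 4 : K)) = 8%N.
Proof.
have -> : - 4 = zK K (- 12%:R) / 3%:R by rewrite ?zKN ?zK0 ?zK_nat; field.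
rewrite /Lam3_ -inset_s8.
apply: (dim_eig_rep s8_ordered (rep_b3 K sub88)) (isT : uniq rs3) _ _; last first.
- by vm_cast_no_check (erefl true).
- by [].
move=> F; rewrite inset_s8 => /b3_shift_prod; rewrite /rs3 /= !zKN !zK_nat => e.
exact: e.
Qed.

Lemma dim_Lam3_23 : \dim (Lam3_ (2 / 3 : K)) = 48%N.
Proof.
have -> : 2 / 3 = zK K (2%:R) / 3%:R by rewrite ?zKN ?zK0 ?zK_nat; field.
rewrite /Lam3_ -inset_s8.
apply: (dim_eig_rep s8_ordered (rep_b3 K sub88)) (isT : uniq rs3) _ _; last first.
- by vm_cast_no_check (erefl true).
- by [].
move=> F; rewrite inset_s8 => /b3_shift_prod; rewrite /rs3 /= !zKN !zK_nat => e.
exact: e.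
Qed.

Lemma dim_Lam4_0 : \dim (Lam4_ (0 : K)) = 35%N.
Proof.
have -> : 0 = zK K (0) / 6%:R by rewrite ?zKN ?zK0 ?zK_nat; field.
rewrite /Lam4_ -inset_s8.
apply: (dim_eig_rep s8_ordered (rep_b4 K sub88)) (isT : uniq rs4) _ _; last first.
- by vm_cast_no_check (erefl true).
- by [].
move=> F; rewrite inset_s8 => /b4_shift_prod; rewrite /rs4 /= !zKN !zK_nat => e.
exact: e.
Qed.

Lemma dim_Lam4_m4 : \dim (Lam4_ (- 4 : K)) = 1%N.
Proof.
have -> : - 4 = zK K (- 24%:R) / 6%:R by rewrite ?zKN ?zK0 ?zK_nat; field.
rewrite /Lam4_ -inset_s8.
apply: (dim_eig_rep s8_ordered (rep_b4 K sub88)) (isT : uniq rs4) _ _; last first.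
- by vm_cast_no_check (erefl true).
- by [].
move=> F; rewrite inset_s8 => /b4_shift_prod; rewrite /rs4 /= !zKN !zK_nat => e.
exact: e.
Qed.

Lemma dim_Lam4_23 : \dim (Lam4_ (2 / 3 : K)) = 27%N.
Proof.
have -> : 2 / 3 = zK K (4%:R) / 6%:R by rewrite ?zKN ?zK0 ?zK_nat; field.
rewrite /Lam4_ -inset_s8.
apply: (dim_eig_rep s8_ordered (rep_b4 K sub88)) (isT : uniq rs4) _ _; last first.
- by vm_cast_no_check (erefl true).
- by [].
move=> F; rewrite inset_s8 => /b4_shift_prod; rewrite /rs4 /= !zKN !zK_nat => e.
exact: e.
Qed.
End Dims.

(** * Independence of eigenspaces *)

Lemma capv_eq0S (F : fieldType) (vT : vectType F) (U V U' V' : {vspace vT}) :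
  (U :&: V = 0)%VS -> (U' <= U)%VS -> (V' <= V)%VS -> (U' :&: V' = 0)%VS.
Proof. by move=> cap0 sU sV; apply/eqP; rewrite -subv0 -cap0 capvS. Qed.

Section EigSum.
Variables (K : numFieldType) (k : nat) (U : {vspace tensor K k}).
Variable f : {linear tensor K k -> tensor K k}.

(** The product of the f - r kills the sum of the r-eigenspaces, but acts on a b-eigenvector by the
    product of the b - r, which is nonzero for a new b. *)
Lemma eig_sum_dim rs : uniq rs ->
  \dim (\sum_(a <- rs) eig U f a)%VS = (\sum_(a <- rs) \dim (eig U f a))%N.
Proof.
have kill r x : x \in (\sum_(a <- r) eig U f a)%VS -> shift_prod f r x = 0.
  elim: r x => [|a r IHr] x; first by rewrite big_nil memv0 => /eqP->.
  rewrite big_cons => /memv_addP[y /eigP[_ fy] [z /IHr z0 ->]].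
  rewrite /= raddfD /= z0 addr0 (shift_prod_eigen _ fy) linearZZ fy.
  by rewrite !scalerA [a * _]mulrC subrr.
elim: rs => [_|b rs IHrs /= /andP[b_rs u_rs]]; first by rewrite !big_nil dimv0.
rewrite !big_cons -(IHrs u_rs) dimv_disjoint_sum //.
apply/eqP; rewrite -subv0; apply/subvP => x; rewrite memv_cap => /andP[/eigP[_ fx] /kill].
rewrite (shift_prod_eigen _ fx) => /eqP; rewrite scaler_eq0 memv0 => /orP[|//].
rewrite prodf_seq_eq0 => /hasP[r r_rs /=]; rewrite subr_eq0 => /eqP e.
by rewrite e r_rs in b_rs.
Qed.

Lemma eig_sum_dim3 a b c : uniq [:: a; b; c] ->
  \dim (eig U f a + eig U f b + eig U f c)%VS =
  (\dim (eig U f a) + \dim (eig U f b) + \dim (eig U f c))%N.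
Proof.
move=> u_abc; have := eig_sum_dim u_abc.
have -> (V : K -> {vspace tensor K k}) : (\sum_(x <- [:: a; b; c]) V x = V a + V b + V c)%VS.
  by rewrite !big_cons big_nil -addvA; congr (_ + (_ + _))%VS; rewrite addv0.
have -> // (N : K -> nat) : (\sum_(x <- [:: a; b; c]) N x = N a + N b + N c)%N.
by rewrite !big_cons big_nil addn0 addnA.
Qed.

Lemma eig_sum_le rs : uniq rs -> (\sum_(a <- rs) \dim (eig U f a) <= \dim U)%N.
Proof.
move=> u_rs; rewrite -eig_sum_dim //; apply: dimvS.
by elim/big_rec: _ => [|a V _ sVU]; rewrite ?sub0v // subv_add capvSl.
Qed.

(* Eigenspaces are independent, so subspaces of them whose dimensions add up to
   \dim U leave no room for anything else. *)
Lemma eig_exhaust (ps : seq (K * {vspace tensor K k})) :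
  uniq (map fst ps) -> (forall p, p \in ps -> (p.2 <= eig U f p.1)%VS) ->
  (\dim U <= \sum_(p <- ps) \dim p.2)%N ->
  (forall p, p \in ps -> eig U f p.1 = p.2) /\
  (forall a, a \notin map fst ps -> eig U f a = 0%VS).
Proof.
move=> u_ps sub_ps dimU.
have le_dims : (\sum_(p <- ps) \dim p.2 <= \sum_(p <- ps) \dim (eig U f p.1))%N.
  by rewrite big_seq [leqRHS]big_seq; apply: leq_sum => p /sub_ps/dimvS.
have := eig_sum_le u_ps; rewrite big_map => ge_dims.
have eq_dims : (\sum_(p <- ps) \dim (eig U f p.1) = \sum_(p <- ps) \dim p.2)%N.
  by apply/eqP; rewrite eqn_leq le_dims (leq_trans ge_dims dimU).
split=> [p p_ps|a a_ps].
  apply/esym/eqP; rewrite -(geq_leqif (dimv_leqif_eq (sub_ps p p_ps))).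
  have up : uniq ps by apply: map_uniq u_ps.
  (* Equal totals and termwise inequalities leave no slack at p. *)
  have := eq_dims; rewrite !(big_rem p p_ps) /= => eq_dims_p.
  rewrite -(leq_add2r (\sum_(q <- rem p ps) \dim q.2)) -eq_dims_p leq_add2l.
  rewrite big_seq [leqRHS]big_seq; apply: leq_sum => q /mem_rem q_ps.
  exact/dimvS/sub_ps.
apply/eqP; rewrite -dimv_eq0 -leqn0 -(leq_add2r (\sum_(p <- ps) \dim p.2)) add0n.
rewrite -{1}eq_dims; apply: leq_trans dimU.
(* With a added to the list the dimensions still sum to at most [\dim U], which the others already
   fill. *)
have := @eig_sum_le (a :: map fst ps); rewrite /= a_ps u_ps => /(_ isT).
by rewrite big_cons big_map.
Qed.
End EigSum.

(** * Products of exterior powers *)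

Section Tensv.
Variable K : numFieldType.

(** The swapped arguments let linearity in the left factor be registered as a structure. *)
Definition wedger p q (B : tensor K q) (A : tensor K p) : tensor K (p + q) := wedge A B.

HB.instance Definition _ p q (B : tensor K q) :=
  GRing.isLinear.Build K (tensor K p) (tensor K (p + q)) *:%R
    (@wedger p q B) (@wedge_linl K p q B).

Lemma tensv_sub p q (U : {vspace tensor K p}) (V : {vspace tensor K q}) (W : {vspace tensor K (p + q)}) :
  (forall u v, u \in U -> v \in V -> wedge u v \in W) -> (tensv U V <= W)%VS.
Proof.
move=> UVW; apply/span_subvP => _ /allpairsP[[u v] /= [u_U v_V ->]].
by apply: UVW; apply: vbasis_mem.
Qed.

Lemma wedge_tensv p q (U : {vspace tensor K p}) (V : {vspace tensor K q}) u v :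
  u \in U -> v \in V -> wedge u v \in tensv U V.
Proof.
move=> /coord_vbasis-> /coord_vbasis->.
rewrite (linear_sum_seq _ _ _ (@wedge_linl K p q _)).
apply: rpred_sum => i _; apply: rpredZ; rewrite linear_sum.
apply: rpred_sum => j _; rewrite linearZ; apply: rpredZ.
by apply: memv_span; apply: allpairs_f; rewrite mem_nth ?size_tuple.
Qed.

Lemma tensv_line p q (U : {vspace tensor K p}) (v : tensor K q) :
  tensv U <[v]> = (linfun (@wedger p q v) @: U)%VS.
Proof.
apply/eqP; rewrite eqEsubv; apply/andP; split.
  apply: tensv_sub => u _ u_U /vlineP[c ->]; rewrite linearZ; apply: rpredZ.
  by apply/memv_imgP; exists u => //; rewrite lfunE.
apply/subvP => _ /memv_imgP[u u_U ->]; rewrite lfunE /=.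
by rewrite wedge_tensv ?memv_line.
Qed.

Lemma cat_subs p q s t l m : uniq (s ++ t) ->
  l \in subs p s -> m \in subs q t -> l ++ m \in subs (p + q) (s ++ t).
Proof.
move=> u_st; have := u_st; rewrite cat_uniq => /and3P[us _ ut].
rewrite !mem_subs // => /andP[sub_l /eqP sz_l] /andP[sub_m /eqP sz_m].
by rewrite size_cat sz_l sz_m eqxx andbT cat_subseq.
Qed.

(** Since [s ++ t] is increasing, so is [l ++ m], and only one pair of monomials contributes, with
    neither sign nor binomial factor. *)
Lemma wedge_tup p q s t (F : tensor K p) (v : tensor K q) l m :
  ordered s -> ordered t -> ordered (s ++ t) ->
  F \in Lam K p (inset s) -> v \in Lam K q (inset t) -> l \in subs p s -> m \in subs q t ->
  wedge F v (tup (p + q) (l ++ m)) = F (tup p l) * v (tup q m).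
Proof.
move=> s_ord t_ord st_ord F_Lam v_Lam l_s m_t.
have us := ordered_uniq s_ord; have ut := ordered_uniq t_ord; have ust := ordered_uniq st_ord.
have [_ sz_l _ _] := subs_sorted s_ord l_s.
have mono_lm l' m' : l' \in subs p s -> m' \in subs q t ->
    wedge (mono K p l') (mono K q m') (tup (p + q) (l ++ m)) = (l' == l)%:R * (m' == m)%:R.
  move=> l'_s m'_t; have [_ sz_l' _ _] := subs_sorted s_ord l'_s.
  rewrite wedge_mono // (mono_tup _ st_ord) ?cat_subs // eqseq_cat ?sz_l' ?sz_l //.
  by rewrite -mulnb natrM.
rewrite {1}(Lam_expand s_ord F_Lam) (linear_sum_seq _ _ _ (@wedge_linl K p q _)).
rewrite sum_ffunE big_seq (eq_bigr (fun l' => F (tup p l') * (l' == l)%:R * v (tup q m))).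
  rewrite -big_seq (bigD1_seq l) ?subs_uniq //= eqxx mulr1 big1 ?addr0 // => l' /negPf->.
  by rewrite mulr0 mul0r.
move=> l' l'_s; rewrite ffunE scale_regE -mulrA; congr (_ * _).
rewrite {1}(Lam_expand t_ord v_Lam) linear_sum sum_ffunE big_seq.
rewrite (eq_bigr (fun m' => v (tup q m') * ((l' == l)%:R * (m' == m)%:R))) => [|m' m'_t].
  rewrite -big_seq (bigD1_seq m) ?subs_uniq //= eqxx mulr1 mulrC big1 ?addr0 // => m' /negPf->.
  by rewrite !mulr0.
by rewrite linearZ ffunE scale_regE mono_lm.
Qed.

Lemma Lam_eq0 k s (F : tensor K k) : ordered s -> F \in Lam K k (inset s) ->
  (forall l, l \in subs k s -> F (tup k l) = 0) -> F = 0.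
Proof.
move=> s_ord F_Lam F0; rewrite (Lam_expand s_ord F_Lam) big_seq big1 // => l /F0->.
by rewrite scale0r.
Qed.

(** Components of the wedge product factor by [wedge_tup], so a nonzero component of v can be
    cancelled. *)
Lemma wedge_inj0 p q (F : tensor K p) (v : tensor K q) :
  F \in Lam K p R8 -> v \in Lam K q R2 -> v != 0 -> wedge F v = 0 -> F = 0.
Proof.
move=> F_Lam v_Lam nz_v Fv0.
rewrite -inset_s2 in v_Lam; rewrite -inset_s8 in F_Lam.
have s2_ordered : ordered s2 by [].
have [m m_s2 nz_m] : exists2 m, m \in subs q s2 & v (tup q m) != 0.
  apply/hasP; apply: contraR nz_v => /hasPn v0; apply/eqP.
  by apply: (Lam_eq0 _ v_Lam) => // m /v0; rewrite negbK => /eqP.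
apply: (Lam_eq0 s8_ordered F_Lam) => l l_s8.
have /eqP := wedge_tup s8_ordered s2_ordered s10_ordered F_Lam v_Lam l_s8 m_s2.
by rewrite Fv0 ffunE eq_sym mulf_eq0 (negPf nz_m) orbF => /eqP.
Qed.

Lemma dim_tensv_line p q (U : {vspace tensor K p}) (v : tensor K q) :
  (U <= Lam K p R8)%VS -> v \in Lam K q R2 -> v != 0 -> \dim (tensv U <[v]>) = \dim U.
Proof.
move=> /subvP U8 v_Lam nz_v; rewrite tensv_line; apply: limg_dim_eq.
apply/eqP; rewrite -subv0; apply/subvP => F; rewrite memv_cap memv_ker lfunE /= memv0.
by case/andP=> /U8 F_Lam /eqP/(wedge_inj0 F_Lam v_Lam nz_v)->.
Qed.
End Tensv.

(** * The decomposition of the four-forms and the blocks of b_hat *)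

Section Decomposition.
Variable K : numFieldType.

Lemma tensv_Lam p q s t : ordered s -> ordered t ->
  tensv (Lam K p (inset s)) (Lam K q (inset t)) =
  <<[seq mono K (p + q) n | n <- [seq l ++ m | l <- subs p s, m <- subs q t]]>>%VS.
Proof.
move=> s_ord t_ord; apply/eqP; rewrite eqEsubv; apply/andP; split.
  apply: tensv_sub => F v F_Lam v_Lam.
  rewrite (Lam_expand s_ord F_Lam) (linear_sum_seq _ _ _ (@wedge_linl K p q _)) big_seq.
  apply: memv_suml => l l_s; apply: memvZ.
  rewrite (Lam_expand t_ord v_Lam) linear_sum big_seq; apply: memv_suml => m m_t.
  have [_ sz_l _ _] := subs_sorted s_ord l_s.
  by rewrite linearZ /= memvZ // wedge_mono // memv_span // map_f // allpairs_f.
apply/span_subvP => _ /mapP[_ /allpairsP[[l m] /= [l_s m_t ->]] ->].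
have [_ sz_l sub_l _] := subs_sorted s_ord l_s.
have [_ sz_m sub_m _] := subs_sorted t_ord m_t.
by rewrite -wedge_mono // wedge_tensv // mono_Lam.
Qed.

Lemma basis_cat3 (vT : vectType K) (I : eqType) (v : I -> vT) (U : {vspace vT}) (r r1 r2 r3 : seq I) :
  basis_of U (map v r) -> perm_eq r ((r1 ++ r2) ++ r3) ->
  [/\ U = (<<map v r1>> + <<map v r2>> + <<map v r3>>)%VS,
      directv (<<map v r1>> + <<map v r2>> + <<map v r3>>) & \dim U = size r].
Proof.
move=> bX perm_r; rewrite (size_basis (X := in_tuple (map v r)) bX) size_map.
move: bX; rewrite (perm_basis _ (perm_map v perm_r)) !map_cat => bX.
split=> //; first by rewrite -(span_basis bX) !span_cat.
have := basis_free bX; rewrite cat_free span_cat => /and3P[free12 _ /directv_addP cap0].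
have := free12; rewrite cat_free => /and3P[_ _ dir12].
by rewrite directv_addE; apply/and3P; split; [| apply: directv_trivial | apply/eqP].
Qed.

Lemma Lam4_R10_decomposition :
  [/\ Lam K 4 R10 = (Lam K 4 R8 + tensv (Lam K 3 R8) (Lam K 1 R2)
                     + tensv (Lam K 2 R8) (Lam K 2 R2))%VS,
      directv (Lam K 4 R8 + tensv (Lam K 3 R8) (Lam K 1 R2)
                     + tensv (Lam K 2 R8) (Lam K 2 R2))%VS
    & \dim (Lam K 4 R10) = 210%N].
Proof.
have s2_ordered : ordered s2 by [].
(* The increasing lists are sorted by how many of the labels 8, 9 they contain: 210 = 70 + 56 * 2 +
   28. *)
have perm_L : perm_eq (subs 4 s10) ((subs 4 s8 ++ [seq l ++ m | l <- subs 3 s8, m <- subs 1 s2])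
    ++ [seq l ++ m | l <- subs 2 s8, m <- subs 2 s2]).
  by vm_cast_no_check (erefl true).
have size_L : size (subs 4 s10) = 210%N by vm_cast_no_check (erefl 210%N).
have := basis_cat3 (mono_basis K 4 s10_ordered) perm_L.
rewrite size_L -(tensv_Lam 3 1 s8_ordered s2_ordered) -(tensv_Lam 2 2 s8_ordered s2_ordered).
by rewrite (span_basis (mono_basis K 4 s8_ordered)) inset_s10 inset_s8 inset_s2.
Qed.

Lemma evec_Lam i : (8 < i <= 10)%N -> evec K i \in Lam K 1 R2.
Proof.
case: i => // i /= lti; rewrite evecE -?inset_s2 ?mono_Lam //=; last by case/andP: lti.
by move=> j; rewrite inE => /eqP->; rewrite mem_iota.
Qed.

Lemma eps_Lam : eps K \in Lam K 2 R2.
Proof. by rewrite epsE -inset_s2 mono_Lam // => j. Qed.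

Lemma Lam1_R2 V : V \in Lam K 1 R2 ->
  V = V [tuple idx 9] *: evec K 9 + V [tuple idx 10] *: evec K 10.
Proof.
rewrite -inset_s2 => /(Lam_expand (isT : ordered s2)) {1}->.
rewrite !evecE // (_ : subs 1 s2 = [:: [:: 8]; [:: 9]]%N) // big_cons big_seq1.
by congr (V _ *: _ + V _ *: _); apply: eq_from_tnth => i; rewrite tnth_mktuple (ord1 i).
Qed.

Lemma Lam2_R2 W : W \in Lam K 2 R2 -> W = W [tuple idx 9; idx 10] *: eps K.
Proof.
rewrite -inset_s2 => /(Lam_expand (isT : ordered s2)) {1}->.
rewrite epsE (_ : subs 2 s2 = [:: [:: 8; 9]]%N) // big_seq1.
congr (W _ *: _); apply: eq_from_tnth => i; rewrite tnth_mktuple.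
by case: i => [[|[|//]]].
Qed.

Lemma wedge_one0 (A : tensor K 4) : A \in Lam K 4 R10 -> wedge A (one0 K) = A.
Proof.
rewrite -inset_s10 => A_Lam; rewrite one0E {2}(Lam_expand s10_ordered A_Lam).
rewrite {1}(Lam_expand s10_ordered A_Lam) (linear_sum_seq _ _ _ (@wedge_linl K 4 0 _)).
apply: eq_big_seq => l /(subs_sorted s10_ordered)[_ sz_l _ _].
by rewrite wedge_mono // cats0.
Qed.

Notation Th := (Theta K).
Notation bh := (bhat (ThetaHat K)).

Lemma wedgeZr p q a (A : tensor K p) (B : tensor K q) : wedge A (a *: B) = a *: wedge A B.
Proof. exact: linearZZ. Qed.

Lemma wedgeDr p q (A : tensor K p) (B D : tensor K q) : wedge A (B + D) = wedge A B + wedge A D.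
Proof. exact: raddfD. Qed.

Lemma wedgeBr p q (A : tensor K p) (B D : tensor K q) : wedge A (B - D) = wedge A B - wedge A D.
Proof. exact: raddfB. Qed.

Lemma bhat_Lam31 F V : F \in Lam K 3 R8 -> V \in Lam K 1 R2 ->
  bh (wedge F V) = (9 / 4) *: wedge (b3 Th F) (star1 V).
Proof.
move=> F_Lam V_Lam; rewrite {1}(Lam1_R2 V_Lam) /star1 wedgeDr wedgeBr !wedgeZr.
have bhP a b u v : bh (a *: u + b *: v) = a *: bh u + b *: bh v.
  by rewrite linearP; congr (_ + _); apply: linearZZ.
rewrite bhP (bhat_e9 F_Lam) (bhat_e10 F_Lam) {bhP}.
move: (wedge _ _) (wedge _ _) (V _) (V _) => x y a b.
by rewrite scaleNr scalerN scalerBr !scalerA [a * _]mulrC [b * _]mulrC.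
Qed.

Lemma bhat_Lam22 F W : F \in Lam K 2 R8 -> W \in Lam K 2 R2 ->
  bh (wedge F W) = 6 *: wedge (ctilde Th F) (star2 W).
Proof.
move=> F_Lam W_Lam; rewrite {1}(Lam2_R2 W_Lam) /star2 wedgeZr [in RHS]wedgeZr.
have bhZ a u : bh (a *: u) = a *: bh u by exact: linearZZ.
have ct_Lam : ctilde Th F \in Lam K 4 R10 by rewrite ctildeE alt_Lam.
by rewrite bhZ (bhat_eps F_Lam) (wedge_one0 ct_Lam) !scalerA mulrC.
Qed.
End Decomposition.

(** Rearranges the seven eigenvalues, divided by I, into increasing order; z is 0. *)
Lemma perm_eq_sort7 (T : eqType) (a b c z d e f : T) :
  perm_eq [:: z; f; a; d; c; e; b] [:: a; b; c; z; d; e; f].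
Proof. by apply/seq.permP => p /=; lia. Qed.

(** * The spectrum in ten dimensions *)

Section Spectrum.
Variables (K : numFieldType) (I r : K).
Hypotheses (I2 : I * I = - 1) (r_gt0 : 0 < r) (r2 : r * r = 2).

Notation Th := (Theta K).
Notation bh := (bhat (ThetaHat K)).
Notation E := (eig (Lam K 4 R10) bh).

Lemma wedge_Lam p q (A : tensor K p) (B : tensor K q) : wedge A B \in Lam K (p + q) R10.
Proof. by rewrite alt_ten memvZ // alt_Lam. Qed.

Lemma R8_R10 k (F : tensor K k) : F \in Lam K k R8 -> F \in Lam K k R10.
Proof. by rewrite -inset_s8; apply: inset_sub_R10. Qed.

Lemma bhZ a u : bh (a *: u) = a *: bh u.
Proof. exact: linearZZ. Qed.

Lemma bhD u v : bh (u + v) = bh u + bh v.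
Proof. exact: raddfD. Qed.

Lemma ctilde_R8 F : F \in Lam K 2 R8 -> ctilde Th F \in Lam K 4 R8.
Proof.
rewrite -inset_s8 => F_Lam; have sub88 : {subset s8 <= s8} by [].
have := rep_Lam s8_ordered (rep_ctilde K sub88) F_Lam.
by move=> /(memvZ 4^-1); rewrite scalerA mulVf ?pnatr_eq0 // scale1r.
Qed.

(* c4 kills every b-eigenvector of b4 with b <> -2 because c4 b4 = -2 c4. *)
Lemma Lam4_kernel b F : b + 2 != 0 -> F \in Lam4_ b -> bh F = 0.
Proof.
move=> nz_b /eigP[F_Lam bF]; have := c4_b4 F_Lam; rewrite bF [c4 _ (_ *: _)]linearZZ.
move/eqP; rewrite -subr_eq0 -scalerBl opprK scaler_eq0 (negPf nz_b) /= => /eqP c0.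
by rewrite bhat_Lam4_R8 // c0 -(scale0r 0) wedgeZl scale0r scaler0.
Qed.

(** On this eigenspace the relation ctilde b2 = - 6 ctilde reads 8 ctilde F = 0. *)
Lemma Lam2_kernel F : F \in Lam2_ 2 -> ctilde Th F = 0.
Proof.
case/eigP=> F_Lam bF; have := ctilde_b2 F_Lam; rewrite bF [ctilde _ (_ *: _)]linearZZ.
move/eqP; rewrite -subr_eq0 -scalerBl opprK -natrD scaler_eq0 pnatr_eq0 /=.
by move/eqP.
Qed.

Definition S0 : {vspace tensor K 4} :=
  (Lam4_ (0 : K) + Lam4_ (-4) + Lam4_ (2 / 3) + tensv (Lam2_ 2) <[eps K]>)%VS.

Lemma S0_sub : (S0 <= E 0)%VS.
Proof.
rewrite !subv_add; apply/andP; split; last first.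
  apply: (@tensv_sub K 2 2) => F _ F2 /vlineP[c ->]; rewrite wedgeZr; apply: memvZ.
  apply/eigP; split; first exact: (@wedge_Lam 2 2).
  have F_Lam : F \in Lam K 2 R8 by case/eigP: F2.
  by rewrite /= bhat_eps // (Lam2_kernel F2) scaler0 scale0r.
have sub b : b + 2 != 0 -> (Lam4_ b <= E 0)%VS.
  move=> nz_b; apply/subvP => F Fb; apply/eigP; rewrite /= scale0r (Lam4_kernel nz_b Fb).
  by case/eigP: Fb => F_Lam _; split; first exact: R8_R10.
apply/andP; split; [apply/andP; split|]; apply: sub.
- by rewrite add0r pnatr_eq0.
- by rewrite (_ : - 4 + 2 = - 2%:R) ?oppr_eq0 ?pnatr_eq0 //; ring.
rewrite (_ : 2 / 3 + 2 = 8%:R / 3%:R); last by field.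
by rewrite mulf_neq0 ?invr_eq0 ?pnatr_eq0.
Qed.

Lemma eps_neq0 : eps K != 0.
Proof.
rewrite epsE; apply/eqP => /(congr1 (fun T : tensor K 2 => T (tup 2 [:: 8; 9]%N))).
have s2_ordered : ordered s2 by [].
by rewrite (mono_tup _ s2_ordered) // ffunE eqxx => /eqP; rewrite oner_eq0.
Qed.

Lemma evec_idx i j : (0 < i <= 10)%N -> (0 < j <= 10)%N ->
  evec K i [tuple idx j] = (i == j)%:R.
Proof.
case: i j => [|i] [|j] //= lti ltj.
by rewrite evecE // mono_sortedE //= inordK // eqseq_cons andbT eqSS.
Qed.

Lemma scale_at (a : K) k (A : tensor K k) t : (a *: A) t = a * A t.
Proof. by rewrite ffunE. Qed.

Lemma sub_at k (A B : tensor K k) t : (A - B) t = A t - B t.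
Proof. by rewrite !ffunE. Qed.

(** The Hodge operator maps e_9 - mu e_10 to e_10 + mu e_9, which is mu times it because mu^2 = -1.
    Conversely, the e_9 component of the eigenvalue equation determines the e_10 component. *)
Lemma Rline_line mu : mu * mu = - 1 -> Rline mu = <[evec K 9 - mu *: evec K 10]>%VS.
Proof.
move=> mu2; apply/vspaceP => V; apply/idP/idP.
  case/eigP=> V_Lam /(congr1 (fun T : tensor K 1 => T [tuple idx 9])).
  rewrite /= /star1 sub_at !scale_at !evec_idx // mulr0 mulr1 sub0r => V10.
  apply/vlineP; exists (V [tuple idx 9]).
  by rewrite {1}(Lam1_R2 V_Lam) scalerBr scalerA mulrC -V10 scaleNr opprK.
case/vlineP=> c ->; apply/eigP; split.
  by rewrite memvZ // memvB ?memvZ // evec_Lam.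
rewrite /= /star1 !scale_at !sub_at !scale_at !evec_idx //.
rewrite mulr0 mulr1 subr0 sub0r mulr1 mulrN scaleNr opprK scalerA [mu * c]mulrC scalerBr !scalerA.
by rewrite -mulrA mu2 mulrN1 scaleNr opprK addrC.
Qed.

Lemma Rline_neq0 mu : evec K 9 - mu *: evec K 10 != 0.
Proof.
apply/eqP => /(congr1 (fun T : tensor K 1 => T [tuple idx 9])).
by rewrite sub_at scale_at !evec_idx // mulr0 subr0 ffunE => /eqP; rewrite oner_eq0.
Qed.

Lemma Rline_Lam mu : evec K 9 - mu *: evec K 10 \in Lam K 1 R2.
Proof. by rewrite memvB ?memvZ // evec_Lam. Qed.

(** For b = -4 the factor 9/4 b is -9, which is why 9 I goes with the line of - I; for b = 2/3 it is
    3/2 and the signs agree. *)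
Lemma S3_sub b mu : mu * mu = - 1 -> (tensv (Lam3_ b) (Rline mu) <= E (9 / 4 * b * mu))%VS.
Proof.
move=> mu2; apply: (@tensv_sub K 3 1) => F V /eigP[F_Lam bF] /eigP[V_Lam sV].
apply/eigP; split; first exact: (@wedge_Lam 3 1).
rewrite /= bhat_Lam31 // bF sV wedgeZl wedgeZr.
by move: (wedge F V) => w; rewrite [LHS]scalerA [LHS]scalerA.
Qed.

Lemma dim_S3 b mu : mu * mu = - 1 -> \dim (tensv (Lam3_ b) (Rline mu)) = \dim (Lam3_ (b : K)).
Proof.
move=> mu2; rewrite (Rline_line mu2).
by apply: dim_tensv_line (Rline_Lam mu) (Rline_neq0 mu); apply: capvSl.
Qed.

Lemma dim_S2 b : \dim (tensv (Lam2_ b) <[eps K]>) = \dim (Lam2_ (b : K)).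
Proof. by apply: dim_tensv_line (eps_Lam K) eps_neq0; apply: capvSl. Qed.

Lemma cap_Lam4_R2 : (Lam K 4 R8 :&: tensv (Lam K 2 R8) (Lam K 2 R2))%VS = 0%VS.
Proof.
have [_ dir _] := Lam4_R10_decomposition K.
have := dir; rewrite directv_addE => /and3P[_ _ /eqP cap0].
exact: capv_eq0S cap0 (addvSl _ _) (subvv _).
Qed.

Definition graph c (F : tensor K 2) : tensor K 4 := c *: ctilde Th F + wedge F (eps K).

Lemma graph_linear c : linear (graph c).
Proof.
move=> a u v; rewrite /graph (wedge_linl (eps K)) (ctilde_is_linear Th) !scalerDr addrACA.
by rewrite !scalerA mulrC.
Qed.
HB.instance Definition _ c :=
  GRing.isLinear.Build K (tensor K 2) (tensor K 4) *:%R (graph c) (graph_linear c).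

Definition S6 c : {vspace tensor K 4} := (linfun (graph c) @: Lam2_ (-6))%VS.

Lemma memS6 c x : x \in S6 c <-> exists2 F, F \in Lam2_ (-6) & x = c *: ctilde Th F + wedge F (eps K).
Proof.
split=> [/memv_imgP[F F6 ->]|[F F6 ->]]; first by exists F; rewrite ?lfunE.
by apply/memv_imgP; exists F; rewrite ?lfunE.
Qed.

(** [graph c] is injective: if it kills F, then F wedge eps lies both in Lambda^4 R^8 and in the
    third summand, hence is 0. *)
Lemma dim_S6 c : \dim (S6 c) = 7%N.
Proof.
apply: etrans (limg_dim_eq _) (dim_Lam2_m6 K); apply/eqP; rewrite -subv0.
apply/subvP => F; rewrite memv_cap memv_ker lfunE /= memv0 => /andP[/eigP[F_Lam _]].
rewrite /graph addrC addr_eq0 => /eqP eF; have := @eps_neq0.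
have : wedge F (eps K) \in (Lam K 4 R8 :&: tensv (Lam K 2 R8) (Lam K 2 R2))%VS.
  by rewrite memv_cap wedge_tensv ?eps_Lam // andbT eF memvN memvZ // ctilde_R8.
rewrite cap_Lam4_R2 memv0 => /eqP F0 nz_eps.
by rewrite (wedge_inj0 F_Lam (eps_Lam K) nz_eps F0).
Qed.

(** As c4 ctilde = -24 on Lambda^2_(-6), b_hat maps (c ctilde F, F wedge eps) to (6 ctilde F, -12 c
    F wedge eps). The hypotheses say that this is a times the pair; they give a^2 = -72. *)
Lemma S6_sub c a : c * a = 6 -> -12 * c = a -> (S6 c <= E a)%VS.
Proof.
move=> ca ac; apply/subvP => _ /memS6[F /eigP[F_Lam bF] ->]; apply/eigP.
have ct_R8 := ctilde_R8 F_Lam; split.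
  by apply: memvD; [apply: memvZ; apply: R8_R10 | apply: (@wedge_Lam 2 2)].
have cct : c4 Th (ctilde Th F) = - 24 *: F.
  rewrite c4_ctilde // [b2 _ F]bF scalerA.
  rewrite -scalerBl; congr (_ *: _); ring.
rewrite /= bhD bhZ (bhat_Lam4_R8 ct_R8) (bhat_eps F_Lam) cct wedgeZl addrC scalerDr.
move: (wedge _ _) (ctilde _ _) => x y.
by rewrite !scalerA [a * c]mulrC ca -ac; congr (_ + _ *: _); field.
Qed.

Lemma S0_dims :
  directv (Lam4_ (0 : K) + Lam4_ (-4) + Lam4_ (2 / 3) + tensv (Lam2_ 2) <[eps K]>)%VS
  /\ \dim S0 = 84%N.
Proof.
have rs_uniq : uniq [:: 0; - 4; 2 / 3 : K].
  have n23 : - 4 < 0 :> K /\ 0 < 2 / 3 :> K by rewrite oppr_lt0 divr_gt0 ?ltr0n.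
  case: n23 => m4 p23; rewrite /= !inE !negb_or (gt_eqF m4) (lt_eqF p23).
  by rewrite (lt_eqF (lt_trans m4 p23)).
have dim3 : \dim (Lam4_ (0 : K) + Lam4_ (-4) + Lam4_ (2 / 3))%VS = 63%N.
    apply: etrans (eig_sum_dim3 _ _ rs_uniq) _.
  have d0 := dim_Lam4_0 K; have d4 := dim_Lam4_m4 K; have d23 := dim_Lam4_23 K.
  by rewrite [X in (X + _ + _)%N]d0 [X in (_ + X + _)%N]d4 [X in (_ + X)%N]d23.
have cap0 : ((Lam4_ (0 : K) + Lam4_ (-4) + Lam4_ (2 / 3)) :&: tensv (Lam2_ 2) <[eps K]> = 0)%VS.
  have sub b : (Lam4_ (b : K) <= Lam K 4 R8)%VS by apply: capvSl.
  apply: (capv_eq0S cap_Lam4_R2); first last.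
    by apply: (@tensv_sub K 2 2) => F v /eigP[F_Lam _] /vlineP[c ->];
      rewrite wedgeZr; apply: memvZ; apply: wedge_tensv F_Lam (eps_Lam K).
  by rewrite 2!subv_add; apply/andP; split; [apply/andP; split|]; apply: sub.
have dimS0 : \dim S0 = 84%N.
  by rewrite /S0 (dimv_disjoint_sum cap0) dim3 dim_S2 dim_Lam2_2.
split; last exact: dimS0.
(* The sum is direct because 84 = 35 + 1 + 27 + 21. *)
rewrite directvE /= [X in X == _]dimS0.
have d0 := dim_Lam4_0 K; have d4 := dim_Lam4_m4 K; have d23 := dim_Lam4_23 K.
have d2 := etrans (dim_S2 2) (dim_Lam2_2 K).
by rewrite [X in (X + _ + _ + _)%N]d0 [X in (_ + X + _ + _)%N]d4 [X in (_ + X + _)%N]d23 [X in (_ + X)%N]d2.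
Qed.

(** Division by I makes the seven numbers real; they are then ordered by 3/2 < 6 r < 9, which
    squaring reduces to 9/4 < 72 < 81. *)
Lemma roots_uniq :
  uniq [:: 0; 9 * I; - (9 * I); 3 / 2 * I; - (3 / 2 * I); 6 * r * I; - (6 * r * I)].
Proof.
have nzI : I != 0.
  by apply: contra_eq_neq I2 => ->; rewrite mul0r eq_sym oppr_eq0 oner_eq0.
pose s := [:: 0; 9; - 9; 3 / 2; - (3 / 2); 6 * r; - (6 * r)].
have -> : [:: 0; 9 * I; - (9 * I); 3 / 2 * I; - (3 / 2 * I); 6 * r * I; - (6 * r * I)] = [seq x * I | x <- s].
  by rewrite /= mul0r !mulNr.
rewrite map_inj_uniq; last exact: mulIf.
have p32 : 0 < 3 / 2 :> K by rewrite divr_gt0 ?ltr0n.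
have lt1 : 3 / 2 < 6 * r.
  rewrite -(ltr_pXn2r (n := 2)) ?nnegrE ?(ltW p32) ?mulr_ge0 ?ler0n ?(ltW r_gt0) //.
  rewrite [(6 * r) ^+ 2]exprMn [r ^+ 2]r2 (_ : (3 / 2) ^+ 2 = 9%:R / 4%:R); last by field.
  by rewrite ltr_pdivrMr ?ltr0n // -natrX -!natrM ltr_nat.
have lt2 : 6 * r < 9.
  rewrite -(ltr_pXn2r (n := 2)) ?nnegrE ?mulr_ge0 ?ler0n ?(ltW r_gt0) //.
  by rewrite [(6 * r) ^+ 2]exprMn [r ^+ 2]r2 -!natrX -natrM ltr_nat.
rewrite (perm_uniq (perm_eq_sort7 _ _ _ _ _ _ _)) lt_sorted_uniq //= !ltrN2 lt1 lt2.
by rewrite oppr_lt0 p32.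
Qed.

Let r_neq0 : r != 0. Proof. by rewrite gt_eqF. Qed.

Definition spaces : seq (K * {vspace tensor K 4}) :=
  [:: (0, S0);
      (9 * I, tensv (Lam3_ (-4)) (Rline (- I))); (- (9 * I), tensv (Lam3_ (-4)) (Rline I));
      (3 / 2 * I, tensv (Lam3_ (2 / 3)) (Rline I)); (- (3 / 2 * I), tensv (Lam3_ (2 / 3)) (Rline (- I)));
      (6 * r * I, S6 (- (I / r))); (- (6 * r * I), S6 (I / r))].

Lemma bhat_spectrum :
  (forall p, p \in spaces -> E p.1 = p.2) /\ (forall a, a \notin map fst spaces -> E a = 0%VS).
Proof.
have mI2 : - I * - I = - 1 by rewrite mulrNN.
apply: eig_exhaust; first exact: roots_uniq.
  have S3 b mu a : mu * mu = - 1 -> a = 9 / 4 * b * mu -> (tensv (Lam3_ b) (Rline mu) <= E a)%VS.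
    by move=> mu2 ->; apply: S3_sub.
  (* Removes r from the denominators, so that [field] has only polynomial identities in I and r to
     prove. *)
  have rV : r^-1 = r / 2.
    by apply: (mulfI r_neq0); rewrite mulfV // mulrA r2 mulfV // pnatr_eq0.
  have Ir_a : - (I / r) * (6 * r * I) = 6.
    transitivity (- 3 * (I * I) * (r * r)); first by rewrite rV; field.
    by rewrite I2 r2; ring.
  have Ir_12 : - 12 * (I / r) = - (6 * r * I) by rewrite rV; field.
  move=> p; rewrite !inE =>
    /orP[/eqP->|/orP[/eqP->|/orP[/eqP->|/orP[/eqP->|/orP[/eqP->|/orP[/eqP->|/eqP->]]]]]] /=.
  - exact: S0_sub.
  - by apply: S3 => //; field.
  - by apply: S3 => //; field.
  - by apply: S3 => //; field.
  - by apply: S3 => //; field.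
  - by apply: S6_sub => //; rewrite mulrN Ir_12 opprK.
  - by apply: S6_sub => //; rewrite mulrN -mulNr.
have dims : [seq \dim p.2 | p <- spaces] = [:: 84; 8; 8; 48; 48; 7; 7]%N.
  have [_ dimS0] := S0_dims.
  have d8 mu (mu2 : mu * mu = - 1) := etrans (dim_S3 (- 4) mu2) (dim_Lam3_m4 K).
  have d48 mu (mu2 : mu * mu = - 1) := etrans (dim_S3 (2 / 3) mu2) (dim_Lam3_23 K).
  congr [:: _; _; _; _; _; _; _].
  - exact: dimS0.
  - exact: d8.
  - exact: d8.
  - exact: d48.
  - exact: d48.
  - exact: dim_S6.
  - exact: dim_S6.
have [_ _ ->] := Lam4_R10_decomposition K.
by rewrite -(big_map (fun p => \dim p.2) xpredT id) dims unlock.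
Qed.

Lemma bhat_eigenspaces :
  [/\ E 0 = S0,
      E (9 * I) = tensv (Lam3_ (-4)) (Rline (- I))
        /\ E (- (9 * I)) = tensv (Lam3_ (-4)) (Rline I),
      E (3 / 2 * I) = tensv (Lam3_ (2 / 3)) (Rline I)
        /\ E (- (3 / 2 * I)) = tensv (Lam3_ (2 / 3)) (Rline (- I))
    & E (6 * r * I) = S6 (- (I / r)) /\ E (- (6 * r * I)) = S6 (I / r)].
Proof.
have [H _] := bhat_spectrum.
have nthH n (lt_n : (n < 7)%N) := H _ (mem_nth (0, 0%VS) (lt_n : (n < size spaces)%N)).
split; last 3 first; try split.
- exact: (nthH 1%N).
- exact: (nthH 2%N).
- exact: (nthH 3%N).
- exact: (nthH 4%N).
- exact: (nthH 5%N).
- exact: (nthH 6%N).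
exact: (nthH 0%N).
Qed.

Lemma bhat_eigenvalues a : E a != 0%VS <->
  a \in [:: 0; 9 * I; - (9 * I); 3 / 2 * I; - (3 / 2 * I); 6 * r * I; - (6 * r * I)].
Proof.
have mI2 : - I * - I = - 1 by rewrite mulrNN.
have [e0 [e9 em9] [e32 em32] [e6 em6]] := bhat_eigenspaces.
have nz (V : {vspace tensor K 4}) b n : E b = V -> \dim V = n.+1 -> E b != 0%VS.
  by move=> -> dimV; rewrite -dimv_eq0 dimV.
split=> [|a_in].
  by apply: contraR => /(proj2 bhat_spectrum)->.
have [_ dimS0] := S0_dims.
have d8 mu (mu2 : mu * mu = - 1) := etrans (dim_S3 (- 4) mu2) (dim_Lam3_m4 K).
have d48 mu (mu2 : mu * mu = - 1) := etrans (dim_S3 (2 / 3) mu2) (dim_Lam3_23 K).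
move: a_in; rewrite !inE =>
  /orP[/eqP->|/orP[/eqP->|/orP[/eqP->|/orP[/eqP->|/orP[/eqP->|/orP[/eqP->|/eqP->]]]]]].
- exact: nz e0 dimS0.
- exact: nz e9 (d8 _ mI2).
- exact: nz em9 (d8 _ I2).
- exact: nz e32 (d48 _ I2).
- exact: nz em32 (d48 _ mI2).
- exact: nz e6 (dim_S6 _).
- exact: nz em6 (dim_S6 _).
Qed.

End Spectrum.

Theorem proposition3p10 (R : realType) :
  [/\ Lam R 4 R10 =
        (Lam R 4 R8 + tensv (Lam R 3 R8) (Lam R 1 R2)
                    + tensv (Lam R 2 R8) (Lam R 2 R2))%VS,
      directv (Lam R 4 R8 + tensv (Lam R 3 R8) (Lam R 1 R2)
                    + tensv (Lam R 2 R8) (Lam R 2 R2))%VS,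
      (forall F, F \in Lam R 4 R10 -> bhat (ThetaHat R) F \in Lam R 4 R10)
    & [/\ forall F, F \in Lam R 4 R8 ->
            bhat (ThetaHat R) F =
              2^-1 *: wedge (c4 (Theta R) F) (star0 (one0 R)),
          forall F V, F \in Lam R 3 R8 -> V \in Lam R 1 R2 ->
            bhat (ThetaHat R) (wedge F V) =
              (9 / 4) *: wedge (b3 (Theta R) F) (star1 V)
        & forall F W, F \in Lam R 2 R8 -> W \in Lam R 2 R2 ->
            bhat (ThetaHat R) (wedge F W) =
              6 *: wedge (ctilde (Theta R) F) (star2 W)]]
  /\
  let C : numClosedFieldType := R[i] in
  let I : C := 'i in
  let rt2 : C := ((Num.sqrt (2 : R))%:C)%C in
  let E (a : C) : {vspace tensor C 4} :=
    eig (Lam C 4 R10) (bhat (ThetaHat C)) a in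
  [/\ forall a : C,
        E a != 0%VS <->
        a \in [:: 0; 9 * I; - (9 * I); 3 / 2 * I; - (3 / 2 * I);
                  6 * rt2 * I; - (6 * rt2 * I)],
      [/\ E 0 = (Lam4_ 0 + Lam4_ (-4) + Lam4_ (2 / 3)
                 + tensv (Lam2_ 2) <[eps C]>)%VS,
          directv (Lam4_ (0 : C) + Lam4_ (-4) + Lam4_ (2 / 3)
                   + tensv (Lam2_ 2) <[eps C]>)%VS,
          [/\ \dim (Lam4_ (0 : C)) = 35%N,
              \dim (Lam4_ (-4 : C)) = 1%N,
              \dim (Lam4_ (2 / 3 : C)) = 27%N
            & \dim (tensv (Lam2_ 2) <[eps C]>) = 21%N]
        & \dim (E 0) = 84%N]
    & forall sg : C, sg \in [:: 1; -1] ->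
      [/\ E (sg * (9 * I)) = tensv (Lam3_ (-4)) (Rline (- (sg * I)))
            /\ \dim (E (sg * (9 * I))) = 8%N,
          E (sg * (3 / 2 * I)) = tensv (Lam3_ (2 / 3)) (Rline (sg * I))
            /\ \dim (E (sg * (3 / 2 * I))) = 48%N
        & (forall x : tensor C 4,
             x \in E (sg * (6 * rt2 * I)) <->
             exists2 F, F \in Lam2_ (-6) &
               x = (- (sg * (I / rt2))) *: ctilde (Theta C) F
                   + wedge F (eps C))
            /\ \dim (E (sg * (6 * rt2 * I))) = 7%N]].
Proof.
split.
  have [dec dir _] := Lam4_R10_decomposition R.
  split=> [||F _|]; [exact: dec | exact: dir | exact: alt_Lam |].
  split=> [F F_Lam|F V|F W]; [|exact: bhat_Lam31|exact: bhat_Lam22].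
  by rewrite /star0 ffunE scale1r bhat_Lam4_R8.
move=> C I rt2 E.
have I2 : I * I = - 1 by rewrite -expr2 sqrCi.
have rt2_gt0 : 0 < rt2 by rewrite ltcR sqrtr_gt0 ltr0n.
have rt22 : rt2 * rt2 = 2.
  by rewrite -rmorphM /= -expr2 sqr_sqrtr ?ler0n // rmorph_nat.
have mI2 : - I * - I = - 1 by rewrite mulrNN.
have [e0 [e9 em9] [e32 em32] [e6 em6]] := bhat_eigenspaces I2 rt2_gt0 rt22.
have [dirS0 dimS0] := S0_dims C.
have d8 mu (mu2 : mu * mu = - 1) := etrans (dim_S3 (- 4) mu2) (dim_Lam3_m4 C).
have d48 mu (mu2 : mu * mu = - 1) := etrans (dim_S3 (2 / 3) mu2) (dim_Lam3_23 C).
split.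
- exact: (bhat_eigenvalues I2 rt2_gt0 rt22).
- split.
  + exact: e0.
  + exact: dirS0.
  + split; [exact: dim_Lam4_0 | exact: dim_Lam4_m4 | exact: dim_Lam4_23 |].
    exact: etrans (dim_S2 2) (dim_Lam2_2 C).
  + by apply: etrans (congr1 _ e0) dimS0.
have S6P a c : E a = S6 c -> (forall x : tensor C 4, x \in E a <->
    exists2 F, F \in Lam2_ (-6) & x = c *: ctilde (Theta C) F + wedge F (eps C)) /\ \dim (E a) = 7%N.
  by move=> ->; split=> [x|]; [apply: memS6 | apply: dim_S6].
move=> sg; rewrite !inE => /orP[] /eqP->; rewrite ?mul1r ?mulN1r ?opprK.
- split; [split; first exact: e9 | split; first exact: e32 | exact: S6P e6].
    by apply: etrans (congr1 _ e9) (d8 _ mI2).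
  by apply: etrans (congr1 _ e32) (d48 _ I2).
- split; [split; first exact: em9 | split; first exact: em32 | exact: S6P em6].
    by apply: etrans (congr1 _ em9) (d8 _ I2).
  by apply: etrans (congr1 _ em32) (d48 _ mI2).
Qed.
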